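(* Let $n,\alpha\ge 1$ be integers such that $8n\equiv 1\pmod{3^{\alpha}}$. Then $d_2(n)\equiv 0\pmod{3^{2\lfloor \alpha/2\rfloor+1}}$.
   Context: Notation: $(a;q)_\infty=\prod_{j\ge 0}(1-aq^j)$. The 2-elongated plane partition function $d_2(n)$ is defined by the generating function $\sum_{n=0}^{\infty} d_2(n)q^n=\dfrac{(q^2;q^2)_\infty^{2}}{(q;q)_\infty^{7}}$. *)

(* Defs.v *)
From mathcomp Require Import all_boot all_order all_algebra.
Set Implicit Arguments.
Unset Strict Implicit.
Unset Printing Implicit Defensive.
Import GRing.Theory.
Local Open Scope ring_scope.

(* A formal power series f(q) = \sum_n f n q^n with integer coefficients. *)
Definition fps := nat -> int.

Definition fps_one : fps := fun n => (n == 0)%:R.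

Definition fps_mul (f g : fps) : fps :=
  fun n => \sum_(i < n.+1) f i * g (n - i)%N.

Definition fps_pow (f : fps) (k : nat) : fps := iter k (fps_mul f) fps_one.

Fixpoint fps_div_seq (f g : fps) (n : nat) : seq int :=
  if n is m.+1 then
    let s := fps_div_seq f g m in
    rcons s (f m - \sum_(i < m) s`_i * g (m - i)%N)
  else [::].

(* The quotient f / g, for g with constant term 1, by long division; it is
   characterised by fps_divK and fps_div_unique below. *)
Definition fps_div (f g : fps) : fps := fun n => (fps_div_seq f g n.+1)`_n.

(* (a; b)_oo = \prod_(j >= 0) (1 - a b^j), for polynomials a, b in the formal
   variable q = 'X, where b has zero constant term. The factors with j > n do
   not affect the coefficient of q^n (qpoch_coef), so that coefficient is read
   off a finite product. *)
Definition qpoch (a b : {poly int}) : fps :=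
  fun n => (\prod_(j < n.+1) (1 - a * b ^+ j))`_n.

Definition d2 : nat -> int :=
  fps_div (fps_pow (qpoch 'X^2 'X^2) 2) (fps_pow (qpoch 'X 'X) 7).

Lemma qpoch_coef (a b : {poly int}) (n N : nat) :
  b`_0 = 0 -> (n < N)%N -> (\prod_(j < N) (1 - a * b ^+ j))`_n = qpoch a b n.
Proof.
move=> b0; elim: N => // N IHN; rewrite ltnS leq_eqVlt => /predU1P[-> // | ltnN].
rewrite big_ord_recr /= mulrBr mulr1 coefB IHN // mulrA.
have /factor_theorem[c ->] : root b 0 by rewrite /root horner_coef0 b0.
by rewrite subr0 exprMn mulrA coefMXn ltnN subr0.
Qed.

Lemma size_fps_div_seq (f g : fps) (n : nat) : size (fps_div_seq f g n) = n.
Proof. by elim: n => //= n IHn; rewrite size_rcons IHn. Qed.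

Lemma nth_fps_div_seq (f g : fps) (n i : nat) :
  (i < n)%N -> (fps_div_seq f g n)`_i = fps_div f g i.
Proof.
elim: n => // n IHn; rewrite ltnS leq_eqVlt => /predU1P[-> // | ltin].
by rewrite /= nth_rcons size_fps_div_seq ltin IHn.
Qed.

Lemma fps_divE (f g : fps) (n : nat) :
  fps_div f g n = f n - \sum_(i < n) fps_div f g i * g (n - i)%N.
Proof.
rewrite {1}/fps_div /= nth_rcons size_fps_div_seq ltnn eqxx.
by congr (_ - _); apply: eq_bigr => i _; rewrite nth_fps_div_seq.
Qed.

Lemma fps_divK (f g : fps) :
  g 0%N = 1 -> fps_mul (fps_div f g) g =1 f.
Proof.
move=> g0 n; rewrite /fps_mul big_ord_recr /= subnn g0 mulr1.
by rewrite [fps_div f g n]fps_divE addrC subrK.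
Qed.

Lemma fps_div_unique (f g h : fps) :
  g 0%N = 1 -> fps_mul h g =1 f -> h =1 fps_div f g.
Proof.
move=> g0 hg n; elim/ltn_ind: n => n IHn; rewrite fps_divE -hg.
rewrite /fps_mul big_ord_recr /= subnn g0 mulr1.
by under eq_bigr => i _ do rewrite IHn //; rewrite [_ + h n]addrC addrK.
Qed.

Lemma fps_pow0 (f : fps) (k : nat) : f 0%N = 1 -> fps_pow f k 0%N = 1.
Proof.
by move=> f0; elim: k => //= k IHk; rewrite /fps_mul big_ord1 f0 mul1r.
Qed.

Lemma d2_generating_function :
  fps_mul d2 (fps_pow (qpoch 'X 'X) 7) =1 fps_pow (qpoch 'X^2 'X^2) 2.
Proof.
apply/fps_divK/fps_pow0.
by rewrite /qpoch big_ord1 expr0 mulr1 coefB coef1 coefX subr0.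
Qed.

(* Main.v *)
(** Put phi = (q;q)^2/(q^2;q^2) and psi = (q^2;q^2)^2/(q;q), so that the generating
    function of d2 is D = 1/(phi^4 psi).  The triple product gives the 3-dissections
      phi(q) = phi(q^9) - 2 q phi1(q^3),   psi(q) = psi1(q^3) + q psi(q^9),
    with phi1 psi1 = phi(q^3) psi(q^3), and taking norms from Z[[q]] to Z[[q^3]] gives
      phi(q^3)^4 - 8 q phi1^3 phi(q^3) = phi^4.
    Let x = q phi1^3 phi(q^3)/phi^4, a Hauptmodul for Gamma_0(6), and
    u = q phi1(q^3)/phi.  These identities become rational parametrisations:
      x(q) = u + 3 u^2 + 3 u^3,    u^3 = x(q^3) (1 + 6 u + 12 u^2),
      q D(q) = D(q^9) w            with w = u (1 + 2 u)^4/(1 + 3 u).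
    So the generating functions of d2 (3^a n - c) are D(q) or D(q^3) times a power
    series in x, and one passes from a to a + 1 by f |-> U_3(f) and f |-> U_3(w f)
    alternately, where U_3 is a trace computed from the cubic equation of u.  Both
    operators shrink the coefficients of high powers of x 3-adically.  It remains to
    find modules of polynomials in x, cut out by lower bounds on the valuations and
    one congruence mod 9 between the first three coefficients, such that U_3(w f) maps
    one to the other, and U_3 maps the latter to 9 times the former.  The denominator
    1 + 9 x is invertible there, and everything is done modulo arbitrary powers of 3. *)
From HB Require Import structures.
Require Import Defs.
From mathcomp Require Import all_boot all_order all_algebra.
From mathcomp Require Import ring zify.
From mathcomp.classical Require Import boolp.
Set Implicit Arguments.
Unset Strict Implicit.
Unset Printing Implicit Defensive.
Import GRing.Theory.
Local Open Scope ring_scope.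

(** * Power series over the integers *)

(** A separate type, so that the ring structure given by the Cauchy product can be attached to it
    and equality is extensional. *)
Record series := Series { scoef :> nat -> int }.

HB.instance Definition _ := gen_eqMixin series.
HB.instance Definition _ := gen_choiceMixin series.

Lemma seriesP (f g : series) : f =1 g -> f = g.
Proof. by case: f g => [f] [g] /= /funext ->. Qed.

Definition sadd (f g : series) := Series (fun n => f n + g n).
Definition sopp (f : series) := Series (fun n => - f n).
Definition szero := Series (fun=> 0).
Definition smul (f g : series) := Series (fps_mul f g).
Definition sone := Series fps_one.

Fact saddA : associative sadd.
Proof. by move=> f g h; apply: seriesP => n; apply: addrA. Qed.
Fact saddC : commutative sadd.
Proof. by move=> f g; apply: seriesP => n; apply: addrC. Qed.
Fact sadd0 : left_id szero sadd.
Proof. by move=> f; apply: seriesP => n; apply: add0r. Qed.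
Fact saddN : left_inverse szero sopp sadd.
Proof. by move=> f; apply: seriesP => n; apply: addNr. Qed.

HB.instance Definition _ :=
  GRing.isZmodule.Build series saddA saddC sadd0 saddN.

Definition trunc (N : nat) (f : fps) : {poly int} := \poly_(i < N) f i.

(** Each coefficient of a product is read off polynomials, so commutativity and associativity are
    inherited from [{poly int}]. *)
Lemma smul_trunc (f g : series) (n N : nat) :
  (n < N)%N -> smul f g n = (trunc N f * trunc N g)`_n.
Proof.
move=> ltnN; rewrite coefM; apply: eq_bigr => i _.
by have ltin := ltn_ord i; rewrite !coef_poly !ifT //; lia.
Qed.

Fact smulC : commutative smul.
Proof.
by move=> f g; apply: seriesP => n; rewrite !(@smul_trunc _ _ n n.+1) // mulrC.
Qed.
Fact smulA : associative smul.
Proof.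
move=> f g h; apply: seriesP => n.
transitivity ((trunc n.+1 f * (trunc n.+1 g * trunc n.+1 h))`_n).
  rewrite coefM; apply: eq_bigr => i _.
  by rewrite coef_poly ltn_ord (@smul_trunc _ _ _ n.+1) // ltnS leq_subr.
rewrite mulrA coefM; apply: eq_bigr => i _.
by rewrite coef_poly ltnS leq_subr -(@smul_trunc _ _ _ n.+1).
Qed.
Fact smul1 : left_id sone smul.
Proof.
move=> f; apply: seriesP => n.
rewrite /= /fps_mul big_ord_recl /= mul1r subn0.
by rewrite big1 ?addr0 // => i _; apply: mul0r.
Qed.
Fact smulD : left_distributive smul sadd.
Proof.
move=> f g h; apply: seriesP => n.
by rewrite /= /fps_mul -big_split; apply: eq_bigr => i _; apply: mulrDl.
Qed.
Fact sone_neq0 : sone != szero.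
Proof. by apply/eqP => /(congr1 (fun f : series => f 0%N)). Qed.

HB.instance Definition _ :=
  GRing.Zmodule_isComNzRing.Build series smulA smulC smul1 smulD sone_neq0.

Lemma scoefD (f g : series) n : (f + g) n = f n + g n. Proof. by []. Qed.
Lemma scoefN (f : series) n : (- f) n = - f n. Proof. by []. Qed.
Lemma scoefB (f g : series) n : (f - g) n = f n - g n. Proof. by []. Qed.
Lemma scoef_sum I (r : seq I) (P : pred I) (F : I -> series) n :
  (\sum_(i <- r | P i) F i) n = \sum_(i <- r | P i) F i n.
Proof. by apply: (big_morph (fun f : series => f n)). Qed.

Definition pol (p : {poly int}) := Series (fun n => p`_n).

Fact pol_zmod : zmod_morphism pol.
Proof. by move=> p r; apply: seriesP => n; rewrite /= coefB. Qed.
HB.instance Definition _ := GRing.isZmodMorphism.Build _ _ pol pol_zmod.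
Fact pol_monoid : monoid_morphism pol.
Proof.
split=> [|p r]; apply: seriesP => n; first by rewrite /= coef1.
by rewrite /= coefM.
Qed.
HB.instance Definition _ := GRing.isMonoidMorphism.Build _ _ pol pol_monoid.

Definition q : series := pol 'X.

Lemma pol_Xn k : pol 'X^k = q ^+ k. Proof. by rewrite rmorphXn. Qed.

Lemma scoef_qnM k (f : series) n :
  (q ^+ k * f) n = if (n < k)%N then 0 else f (n - k)%N.
Proof.
rewrite -pol_Xn /= /fps_mul.
have [ltnk|lekn] := ltnP n k.
  by rewrite big1 // => i _; rewrite /= coefXn; case: eqP (ltn_ord i) => [|_ _];
    [lia|apply: mul0r].
rewrite (bigD1 (Ordinal (lekn : (k < n.+1)%N))) //= coefXn eqxx mul1r big1 ?addr0 // => i.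
by rewrite -val_eqE /= coefXn => /negPf ->; apply: mul0r.
Qed.

Lemma scoef_qM (f : series) n : (q * f) n = if n is m.+1 then f m else 0.
Proof. by rewrite -[q]expr1 scoef_qnM; case: n => // n; rewrite subn1. Qed.

Lemma scoef_natM k (f : series) n : (k%:R * f) n = k%:R * f n.
Proof.
by elim: k => [|k IHk]; rewrite ?mul0r // !mulrSr !mulrDl !mul1r scoefD IHk.
Qed.

(** * Congruence modulo powers of q *)

Definition eqmod (N : nat) (f g : series) := forall n, (n < N)%N -> f n = g n.

Lemma eqmod_refl N f : eqmod N f f. Proof. by []. Qed.
Lemma eqmod_sym N f g : eqmod N f g -> eqmod N g f.
Proof. by move=> fg n /fg. Qed.
Lemma eqmod_trans N f g h : eqmod N f g -> eqmod N g h -> eqmod N f h.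
Proof. by move=> fg gh n ltnN; rewrite fg ?gh. Qed.
Lemma eqmodW M N f g : (M <= N)%N -> eqmod N f g -> eqmod M f g.
Proof. by move=> leMN fg n ltnM; apply/fg/(leq_trans ltnM). Qed.
(** Infinite products and sums are handled as limits: modulo q^N they become finite, and an identity
    is proved there for every N. *)
Lemma eqmodP f g : (forall N, eqmod N f g) -> f = g.
Proof. by move=> fg; apply: seriesP => n; apply: (fg n.+1). Qed.
Lemma eqmodD N f g f' g' :
  eqmod N f g -> eqmod N f' g' -> eqmod N (f + f') (g + g').
Proof. by move=> fg fg' n ltnN; rewrite !scoefD fg ?fg'. Qed.
Lemma eqmodN N f g : eqmod N f g -> eqmod N (- f) (- g).
Proof. by move=> fg n ltnN; rewrite !scoefN fg. Qed.
Lemma eqmodM N f g f' g' :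
  eqmod N f g -> eqmod N f' g' -> eqmod N (f * f') (g * g').
Proof.
move=> fg fg' n ltnN; apply: eq_bigr => i _.
by have ltin := ltn_ord i; rewrite fg ?fg' //; lia.
Qed.
Lemma eqmodX N f g k : eqmod N f g -> eqmod N (f ^+ k) (g ^+ k).
Proof. by move=> fg; elim: k => // k IHk; rewrite !exprS; apply: eqmodM. Qed.
Lemma eqmod_sum N (I : Type) (r : seq I) (P : pred I) (F G : I -> series) :
  (forall i, P i -> eqmod N (F i) (G i)) ->
  eqmod N (\sum_(i <- r | P i) F i) (\sum_(i <- r | P i) G i).
Proof.
by move=> FG; apply: (big_ind2 (eqmod N)) => // *; apply: eqmodD.
Qed.
Lemma eqmod_qnM N k f g : eqmod (N - k) f g -> eqmod N (q ^+ k * f) (q ^+ k * g).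
Proof.
by move=> fg n ltnN; rewrite !scoef_qnM; case: ltnP => // lekn; apply: fg; lia.
Qed.
Lemma eqmod_trunc N (f : series) : eqmod N f (pol (trunc N f)).
Proof. by move=> n ltnN; rewrite /= coef_poly ltnN. Qed.

Lemma smul_coef0 (f g : series) : (f * g) 0%N = f 0%N * g 0%N.
Proof. by rewrite /= /fps_mul big_ord1. Qed.

Definition sinv (f : series) := Series (fps_div fps_one f).

Lemma sinvK (f : series) : f 0%N = 1 -> sinv f * f = 1.
Proof. by move=> f0; apply: seriesP => n; apply: fps_divK. Qed.

(** Identities between quotients are proved by multiplying by denominators with constant term 1 and
    cancelling them here. *)
Lemma smulI (f g h : series) : f 0%N = 1 -> f * g = f * h -> g = h.
Proof.
by move=> f0 fgh; rewrite -[g]mul1r -[h]mul1r -(sinvK f0) -!mulrA fgh.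
Qed.

Lemma eqmod_mulI N (f g h : series) :
  f 0%N = 1 -> eqmod N (f * g) (f * h) -> eqmod N g h.
Proof.
move=> f0 fgh; rewrite -[g]mul1r -[h]mul1r -(sinvK f0) -!mulrA.
exact: eqmodM.
Qed.

Lemma series_natI k (f g : series) : (0 < k)%N -> k%:R * f = k%:R * g -> f = g.
Proof.
move=> k0 fg; apply: seriesP => n; have := congr1 (fun h : series => h n) fg.
rewrite !scoef_natM; apply: mulfI; lia.
Qed.

(* f(q^k) *)
Definition dilate (k : nat) (f : series) :=
  Series (fun n => if (k %| n)%N then f (n %/ k)%N else 0).

Lemma dilate_pol k p : (0 < k)%N -> dilate k (pol p) = pol (p \Po 'X^k).
Proof. by move=> k0; apply: seriesP => n; rewrite /= coef_comp_poly_Xn. Qed.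

Lemma eqmod_dilate k N f g : (0 < k)%N -> eqmod N f g ->
  eqmod (k * N) (dilate k f) (dilate k g).
Proof.
move=> k0 fg n ltn /=; case: ifP => // kn; apply: fg.
by rewrite ltn_divLR // mulnC.
Qed.

Section Dilate.
Variables (k : nat) (k0 : (0 < k)%N).

Lemma dilate_zmod : zmod_morphism (dilate k).
Proof.
by move=> f g; apply: seriesP => n; rewrite scoefB /=; case: ifP; rewrite ?subr0.
Qed.

(** On truncations, dilation is composition with ['X^k], which is multiplicative. *)
Lemma dilate_monoid : monoid_morphism (dilate k).
Proof.
split=> [|f g].
  by rewrite -[in LHS](rmorph1 pol) dilate_pol // rmorph1 rmorph1.
apply: eqmodP => N; apply: (eqmodW (leq_pmull N k0)).
apply: (eqmod_trans (eqmod_dilate k0 (eqmodM (@eqmod_trunc N f) (@eqmod_trunc N g)))).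
rewrite -rmorphM dilate_pol // comp_polyM rmorphM /= -!dilate_pol //.
by apply/eqmod_sym; apply: eqmodM; apply: eqmod_dilate => //; apply: eqmod_trunc.
Qed.

Lemma dilate_q : dilate k q = q ^+ k.
Proof. by rewrite dilate_pol // comp_polyX pol_Xn. Qed.
End Dilate.

HB.instance Definition _ k :=
  GRing.isZmodMorphism.Build _ _ (dilate k.+1) (dilate_zmod k.+1).
HB.instance Definition _ k :=
  GRing.isMonoidMorphism.Build _ _ (dilate k.+1) (dilate_monoid (ltn0Sn k)).

(** * Trisection and norm *)

(* f(q) = \sum_(r < 3) q^r (sect r f)(q^3); sect 0 is Atkin's operator U_3. *)
Definition sect (r : nat) (f : series) := Series (fun n => f (3 * n + r)%N).

Lemma scoef_sect r f n : sect r f n = f (3 * n + r)%N. Proof. by []. Qed.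

Lemma sectD r f g : sect r (f + g) = sect r f + sect r g.
Proof. exact: seriesP. Qed.

Fact sect_zmod r : zmod_morphism (sect r).
Proof. by move=> f g; apply: seriesP. Qed.
HB.instance Definition _ r := GRing.isZmodMorphism.Build _ _ (sect r) (sect_zmod r).

Lemma eqmod_sect r N f g : (r < 3)%N -> eqmod (3 * N) f g -> eqmod N (sect r f) (sect r g).
Proof. by move=> r3 fg n ltnN; apply: fg; lia. Qed.

Lemma sect_qn_dilate i r f : (i < 3)%N -> (r < 3)%N ->
  sect r (q ^+ i * dilate 3 f) = if i == r then f else 0.
Proof.
move=> i3 r3; apply: seriesP => n; rewrite scoef_sect scoef_qnM /=.
have [->|/eqP neq] := eqVneq i r.
  by rewrite ifN ?ifT; [congr (f _); lia|lia|lia].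
by case: ltnP => // le; rewrite ifN //; lia.
Qed.

Lemma sect_inj f g : sect 0 f = sect 0 g -> sect 1 f = sect 1 g -> sect 2 f = sect 2 g -> f = g.
Proof.
move=> fg0 fg1 fg2; apply: seriesP => n; rewrite (divn_eq n 3) mulnC.
have: (n %% 3 < 3)%N by rewrite ltn_mod.
case: (n %% 3)%N => [|[|[|]]] // _.
- exact: (congr1 (fun h : series => h (n %/ 3)%N) fg0).
- exact: (congr1 (fun h : series => h (n %/ 3)%N) fg1).
- exact: (congr1 (fun h : series => h (n %/ 3)%N) fg2).
Qed.

Lemma sect_tri (a b c : series) (f := dilate 3 a + q * dilate 3 b + q ^+ 2 * dilate 3 c) :
  (sect 0 f = a) * (sect 1 f = b) * (sect 2 f = c).
Proof.
have -> : f = q ^+ 0 * dilate 3 a + q ^+ 1 * dilate 3 b + q ^+ 2 * dilate 3 c by rewrite /f;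
  ring.
by rewrite !sectD !sect_qn_dilate //= !(addr0, add0r).
Qed.

Lemma sect_decomp f : f = dilate 3 (sect 0 f) + q * dilate 3 (sect 1 f)
  + q ^+ 2 * dilate 3 (sect 2 f).
Proof. by apply: sect_inj; rewrite sect_tri. Qed.

(** U_3 is linear over Z[[q^3]], so it is determined by its values on 1, u, u^2 wherever a series is
    quadratic in u over Z[[q^3]]. *)
Lemma sect_dilateM h f : sect 0 (dilate 3 h * f) = h * sect 0 f.
Proof.
rewrite {1}[f]sect_decomp.
have -> : dilate 3 h * (dilate 3 (sect 0 f) + q * dilate 3 (sect 1 f)
  + q ^+ 2 * dilate 3 (sect 2 f)) =
  dilate 3 (h * sect 0 f) + q * dilate 3 (h * sect 1 f) + q ^+ 2 * dilate 3 (h * sect 2 f).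
  by rewrite !rmorphM /=; ring.
by rewrite sect_tri.
Qed.

(* The norm from Z[[q]] to Z[[q^3]], read as a series in q: for f(q) it is the
   product of the f(z q), z^3 = 1, with q^3 replaced by q. *)
Definition norm3 (f : series) : series :=
  sect 0 f ^+ 3 + q * sect 1 f ^+ 3 + q ^+ 2 * sect 2 f ^+ 3
  - 3%:R * q * (sect 0 f * sect 1 f * sect 2 f).

Lemma norm3_tri a b c :
  norm3 (dilate 3 a + q * dilate 3 b + q ^+ 2 * dilate 3 c) =
  a ^+ 3 + q * b ^+ 3 + q ^+ 2 * c ^+ 3 - 3%:R * q * (a * b * c).
Proof. by rewrite /norm3 !sect_tri. Qed.

(** In the basis 1, q, q^2 over Z[[q^3]] this is the multiplicativity of a cubic norm form, a
    polynomial identity. *)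
Lemma norm3M f g : norm3 (f * g) = norm3 f * norm3 g.
Proof.
rewrite /norm3 [in LHS](sect_decomp f) [in LHS](sect_decomp g).
move: (sect 0 f) (sect 1 f) (sect 2 f) (sect 0 g) (sect 1 g) (sect 2 g) => a b c a' b' c'.
have -> : (dilate 3 a + q * dilate 3 b + q ^+ 2 * dilate 3 c) *
    (dilate 3 a' + q * dilate 3 b' + q ^+ 2 * dilate 3 c') =
  dilate 3 (a * a' + q * (b * c' + c * b')) +
  q * dilate 3 (a * b' + b * a' + q * (c * c')) +
  q ^+ 2 * dilate 3 (a * c' + b * b' + c * a').
  by rewrite !(rmorphD, rmorphM) /= dilate_q //; ring.
by rewrite !sect_tri; ring.
Qed.

Lemma norm3_1 : norm3 1 = 1.
Proof.
have -> : 1 = dilate 3 1 + q * dilate 3 0 + q ^+ 2 * dilate 3 0 by rewrite rmorph1 rmorph0;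
  ring.
by rewrite norm3_tri rmorph1 rmorph0; ring.
Qed.

Lemma norm3X f n : norm3 (f ^+ n) = norm3 f ^+ n.
Proof. by elim: n => [|n IHn]; rewrite ?norm3_1 // !exprS norm3M IHn. Qed.

Lemma norm3_prod I (r : seq I) (F : I -> series) :
  norm3 (\prod_(i <- r) F i) = \prod_(i <- r) norm3 (F i).
Proof. by apply: (big_morph _ norm3M norm3_1). Qed.

Lemma eqmod_norm3 N f g : eqmod (3 * N) f g -> eqmod N (norm3 f) (norm3 g).
Proof.
move=> fg; have E r : (r < 3)%N -> eqmod N (sect r f) (sect r g) by move/eqmod_sect; apply.
have E0 := E 0%N isT; have E1 := E 1%N isT; have E2 := E 2%N isT.
rewrite /norm3; apply: eqmodD; last first.
  by apply: eqmodN; apply: eqmodM => //; apply: eqmodM => //; apply: eqmodM.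
apply: eqmodD; first apply: eqmodD; first exact: eqmodX.
  by apply: eqmodM => //; apply: eqmodX.
by apply: eqmodM => //; apply: eqmodX.
Qed.

Lemma dilate3_qn n : dilate 3 (q ^+ n) = q ^+ (3 * n).
Proof. by rewrite rmorphXn /= dilate_q // exprM. Qed.

(** The product of 1 - z^n q^n over z^3 = 1 is (1 - q^n)^3 if 3 divides n and 1 - q^(3n) otherwise;
    then q^3 is replaced by q. *)
Lemma norm3_1subq n :
  norm3 (1 - q ^+ n) = if (3 %| n)%N then (1 - q ^+ (n %/ 3)) ^+ 3 else 1 - q ^+ n.
Proof.
have := divn_eq n 3; have: (n %% 3 < 3)%N by rewrite ltn_mod.
set m := (n %/ 3)%N; case: (n %% 3)%N => [|[|[|]]] // _ ->; rewrite mulnC ?addn0.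
- rewrite dvdn_mulr //.
  have -> : 1 - q ^+ (3 * m) = dilate 3 (1 - q ^+ m) + q * dilate 3 0 + q ^+ 2 * dilate 3 0.
    by rewrite rmorphB rmorph1 /= dilate3_qn rmorph0; ring.
  by rewrite norm3_tri; ring.
- rewrite ifN; last by lia.
  have E : 1 - q ^+ (3 * m + 1) = dilate 3 1 + q * dilate 3 (- q ^+ m) + q ^+ 2 * dilate 3 0.
    by rewrite rmorphN rmorph1 /= dilate3_qn rmorph0 exprD; ring.
  by rewrite {1}E norm3_tri exprD mulnC exprM; ring.
- rewrite ifN; last by lia.
  have E : 1 - q ^+ (3 * m + 2) = dilate 3 1 + q * dilate 3 0 + q ^+ 2 * dilate 3 (- q ^+ m).
    by rewrite rmorphN rmorph1 /= dilate3_qn rmorph0 exprD; ring.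
  by rewrite {1}E norm3_tri exprD mulnC exprM; ring.
Qed.

Lemma norm3_dilate f : norm3 (dilate 3 f) = f ^+ 3.
Proof.
have -> : dilate 3 f = dilate 3 f + q * dilate 3 0 + q ^+ 2 * dilate 3 0 by rewrite rmorph0;
  ring.
by rewrite norm3_tri; ring.
Qed.

(** * Infinite products *)

(* (c q^b; q^a)_oo *)
Definition qprod (c : int) (b a : nat) := Series (qpoch (c%:P * 'X^b) 'X^a).

Definition euler (k : nat) := qprod 1 k k.

Lemma eqmod_qprod c b a N M : (0 < a)%N -> (N <= M)%N ->
  eqmod N (qprod c b a) (\prod_(j < M) (1 - c%:~R * q ^+ (b + a * j))).
Proof.
move=> a0 leNM n ltnN; rewrite /= -(@qpoch_coef _ _ n M) //; last first.
- exact: leq_trans leNM.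
- by rewrite coefXn; case: a a0.
transitivity (pol (\prod_(j < M) (1 - c%:P * 'X^b * 'X^a ^+ j)) n); first by [].
rewrite rmorph_prod /=; congr (scoef _ _); apply: eq_bigr => j _.
rewrite rmorphB rmorph1 !rmorphM /= -exprM !pol_Xn exprD mulrA; congr (_ - _ * _ * _).
by rewrite -[c in LHS]intz !rmorph_int.
Qed.

Lemma eqmod_eq N f g : f = g -> eqmod N f g. Proof. by move->. Qed.

Lemma eqmod_prod N (I : Type) (r : seq I) (F G : I -> series) :
  (forall i, eqmod N (F i) (G i)) ->
  eqmod N (\prod_(i <- r) F i) (\prod_(i <- r) G i).
Proof.
by move=> FG; apply: (big_ind2 (eqmod N)) => // *; apply: eqmodM.
Qed.

Lemma big_ord_mul (R : Type) (idx : R) (op : Monoid.com_law idx) m N (F : nat -> R) :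
  \big[op/idx]_(j < m * N) F j =
  \big[op/idx]_(r < m) \big[op/idx]_(j < N) F (r + m * j)%N.
Proof.
rewrite exchange_big /=; elim: N => [|N IHN]; first by rewrite muln0 !big_ord0.
rewrite mulnSr big_split_ord /= IHN [in RHS]big_ord_recr /=; congr (op _ _).
by apply: eq_bigr => r _; rewrite addnC.
Qed.

Lemma qprod_split m c b a : (0 < m)%N -> (0 < a)%N ->
  qprod c b a = \prod_(r < m) qprod c (b + a * r) (a * m).
Proof.
move=> m_gt0 a0; apply: eqmodP => N.
apply: (eqmod_trans (eqmod_qprod c b a0 (leq_pmull N m_gt0))).
rewrite (@big_ord_mul _ _ _ m N (fun j => 1 - c%:~R * q ^+ (b + a * j))).
apply: eqmod_prod => r; apply: eqmod_sym.
have am0 : (0 < a * m)%N by rewrite muln_gt0 a0.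
have := @eqmod_qprod c (b + a * r) (a * m) N N am0 (leqnn N).
congr eqmod; apply: eq_bigr => j _; congr (1 - _ * q ^+ _); ring.
Qed.

Lemma qprod_sign b a : (0 < a)%N ->
  qprod (-1) b a * qprod 1 b a = qprod 1 (2 * b) (2 * a).
Proof.
move=> a0; apply: eqmodP => N.
have a20 : (0 < 2 * a)%N by rewrite muln_gt0 a0.
apply: (eqmod_trans (eqmodM (eqmod_qprod (-1) b a0 (leqnn N))
                            (eqmod_qprod 1 b a0 (leqnn N)))).
apply: eqmod_sym; apply: (eqmod_trans (eqmod_qprod _ _ a20 (leqnn N))).
rewrite -big_split; apply: eqmod_eq; apply: eq_bigr => j _ /=.
have -> : (2 * b + 2 * a * j = (b + a * j) * 2)%N by ring.
by rewrite exprM; ring.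
Qed.

Lemma dilate_euler k j : (0 < k)%N -> dilate j.+1 (euler k) = euler (j.+1 * k).
Proof.
move=> k0; apply: eqmodP => N; have jk0 : (0 < j.+1 * k)%N by rewrite muln_gt0 k0.
apply: (eqmodW (leq_pmull N (ltn0Sn j))).
have leN : (j.+1 * N <= j.+1 * N)%N by [].
apply: (eqmod_trans (eqmod_dilate (ltn0Sn j) (eqmod_qprod 1 k k0 (leq_pmull N (ltn0Sn j))))).
apply: eqmod_sym; apply: eqmod_trans (eqmod_qprod 1 _ jk0 (leqnn _)) _.
rewrite rmorph_prod /=; apply: eqmod_eq; apply: eq_bigr => i _.
rewrite !mul1r rmorphB rmorph1 rmorphXn /= dilate_q // -exprM.
by congr (_ - _ ^+ _); ring.
Qed.

Lemma qprod0 c b a : (0 < b)%N -> qprod c b a 0%N = 1.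
Proof.
by move=> b0; rewrite /= /qpoch big_ord1 expr0 mulr1 coefB coef1 coefMXn b0 subr0.
Qed.

Lemma euler0 k : (0 < k)%N -> euler k 0%N = 1.
Proof. exact: qprod0. Qed.

Lemma norm3_qprod b a : (0 < a)%N -> (3 %| a)%N -> ~~ (3 %| b)%N ->
  norm3 (qprod 1 b a) = qprod 1 b a.
Proof.
move=> a0 a3 b3; apply: eqmodP => N.
have le3N : (N <= 3 * N)%N by rewrite leq_pmull.
apply: (eqmod_trans (eqmod_norm3 (eqmod_qprod 1 b a0 (leqnn (3 * N))))).
apply: eqmod_sym; apply: (eqmod_trans (eqmod_qprod 1 b a0 le3N)).
rewrite norm3_prod; apply: eqmod_eq; apply: eq_bigr => j _.
by rewrite mul1r norm3_1subq dvdn_addl ?(negPf b3) // dvdn_mulr.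
Qed.

(** The factors with exponent prime to 3 are fixed by the norm; the others form [euler (3 * k)],
    whose norm is [euler k ^+ 3]. *)
Lemma norm3_euler k : ~~ (3 %| k)%N -> norm3 (euler k) * euler (3 * k) = euler k ^+ 4.
Proof.
move=> k3; have k0 : (0 < k)%N by case: k k3.
have k30 : (0 < k * 3)%N by rewrite muln_gt0 k0.
have k33 : (3 %| k * 3)%N by rewrite dvdn_mull.
have Ek : euler k = qprod 1 k (k * 3) * qprod 1 (k * 2) (k * 3) * euler (3 * k).
  rewrite {1}/euler (@qprod_split 3) // !big_ord_recr big_ord0 /= mul1r.
  by congr (qprod _ _ _ * qprod _ _ _ * qprod _ _ _); ring.
rewrite {1}Ek !norm3M (norm3_qprod k30 k33 k3) norm3_qprod //; last by lia.
have -> : norm3 (euler (3 * k)) = euler k ^+ 3 by rewrite -(dilate_euler 2) // norm3_dilate.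
by rewrite [in RHS]exprS {2}Ek; ring.
Qed.

(** * Gaussian binomials and the finite triple product *)

Lemma bin2S n : 'C(n.+1, 2) = ('C(n, 2) + n)%N.
Proof. by rewrite binS bin1. Qed.

Section FiniteTripleProduct.
Variables (R : comNzRingType) (Q : R).

(* The Gaussian binomial [2N choose N+k]_Q, which is symmetric in k. *)
Fixpoint gbin (N k : nat) : R :=
  match N, k with
  | 0, _ => (k == 0)%:R
  | M.+1, 0 => (1 + Q ^+ (2 * M + 1)) * gbin M 0 + 2%:R * Q ^+ M.+1 * gbin M 1
  | M.+1, l.+1 => (1 + Q ^+ (2 * M + 1)) * gbin M l.+1
                  + Q ^+ (M - l) * gbin M l + Q ^+ (M + l + 2) * gbin M l.+2
  end.

Lemma gbin_gt N k : (N < k)%N -> gbin N k = 0.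
Proof.
elim: N k => [|N IHN] [|k] //= ltNk.
by rewrite !IHN ?mulr0 ?addr0 //; lia.
Qed.

Definition qfac n : R := \prod_(j < n) (1 - Q ^+ j.+1).

Lemma qfacS n : qfac n.+1 = qfac n * (1 - Q ^+ n.+1).
Proof. exact: big_ord_recr. Qed.

(** The closed form is multiplied out because the ring is arbitrary. It later yields the limit of
    [gbin] as N grows. *)
Lemma gbinE N k : (k <= N)%N -> gbin N k * qfac (N + k) * qfac (N - k) = qfac (2 * N).
Proof.
elim: N k => [|N IHN] k leN.
  by case: k leN => // _; rewrite /= /qfac !big_ord0; ring.
(* The induction hypothesis, extended to l = N + 1, where both sides vanish. *)
have IH1 l : (l <= N.+1)%N ->
    gbin N l * qfac (N + l) * qfac (N.+1 - l) = (1 - Q ^+ (N.+1 - l)) * qfac (2 * N).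
  rewrite leq_eqVlt => /predU1P[->|]; first by rewrite gbin_gt // subnn; ring.
  by rewrite ltnS => leN'; rewrite subSn // qfacS -(IHN l) //; ring.
have -> : qfac (2 * N.+1) = qfac (2 * N) * (1 - Q ^+ (2 * N).+1) * (1 - Q ^+ (2 * N).+2).
  by rewrite -!qfacS; congr qfac; lia.
case: k leN => [|k] leN.
  rewrite addn0 subn0 qfacS /= addn1.
  have := IHN 0%N isT; rewrite addn0 subn0 => h0.
  have := IH1 1%N isT; rewrite addn1 subn1 /= qfacS => h1.
  transitivity ((1 + Q ^+ (2 * N).+1) * (1 - Q ^+ N.+1) ^+ 2 * (gbin N 0 * qfac N * qfac N)
      + 2%:R * Q ^+ N.+1 * (1 - Q ^+ N.+1) * (gbin N 1 * (qfac N * (1 - Q ^+ N.+1)) * qfac N)).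
    by ring.
  rewrite h0 h1 !exprS mul2n -addnn exprD.
  by move: (Q ^+ N) (qfac (N + N)) => z f; ring.
rewrite ltnS in leN; rewrite subSS.
(* At the top index only the middle term of the recurrence survives. *)
have [->|neq] := eqVneq k N.
  rewrite /= gbin_gt // (gbin_gt (leqnSn _)) subnn /= !(mulr0, add0r, addr0).
  have := IHN N (leqnn N); rewrite subnn => h.
  rewrite addSn addnS !qfacS -h mul2n -addnn.
  by move: (Q ^+ (N + N).+1) (Q ^+ (N + N).+2) => y z; ring.
have [d eN] : exists d, N = (k.+1 + d)%N by exists (N - k.+1)%N; lia.
have e2 : (N.+1 - k.+2 = d)%N by lia.
have e1 : (N - k.+1 = d)%N by lia.
have e0 : (N - k = d.+1)%N by lia.
have h1 : _ = _ := IHN k.+1 ltac:(lia); have h0 := IHN k leN.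
have h2 : _ = _ := IH1 k.+2 ltac:(lia).
rewrite e1 addnS !qfacS in h1; rewrite e0 !qfacS in h0.
rewrite e2 !addnS !qfacS in h2.
rewrite addSn addnS e0 !qfacS /= addn2 addn1 e0.
move: h0 h1 h2; set g0 := gbin N k; set g1 := gbin N k.+1; set g2 := gbin N k.+2.
set F := qfac (N + k); set G := qfac d; set H := qfac (2 * N) => h0 h1 h2.
transitivity ((1 + Q ^+ (2 * N).+1) * (1 - Q ^+ (N + k).+2) * (1 - Q ^+ d.+1) *
    (g1 * (F * (1 - Q ^+ (N + k).+1)) * G)
  + Q ^+ d.+1 * (1 - Q ^+ (N + k).+1) * (1 - Q ^+ (N + k).+2) * (g0 * F * (G * (1 - Q ^+ d.+1)))
  + Q ^+ (N + k).+2 * (1 - Q ^+ d.+1) *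
    (g2 * (F * (1 - Q ^+ (N + k).+1) * (1 - Q ^+ (N + k).+2)) * G)); first by ring.
rewrite h0 h1 h2.
have eQ : Q ^+ (2 * N).+1 = Q ^+ (N + k).+1 * Q ^+ d.+1.
  by rewrite -exprD; congr (_ ^+ _); lia.
rewrite [Q ^+ (2 * N).+2]exprS [Q ^+ (N + k).+2]exprS eQ [Q ^+ d.+1]exprS.
by move: (Q ^+ (N + k).+1) (Q ^+ d) => y z; ring.
Qed.

Variables a b : R.
Hypothesis abQ : a * b = Q.

Lemma gbin_sum_widen M N (F : nat -> R) : (N <= M)%N ->
  \sum_(k < N) gbin N k.+1 * F k = \sum_(k < M) gbin N k.+1 * F k.
Proof.
move=> leNM; rewrite (big_ord_widen M (fun k => gbin N k.+1 * F k)) //.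
rewrite big_mkcond; apply: eq_bigr => k _.
by case: ltnP => // leNk; rewrite gbin_gt ?mul0r.
Qed.

(** Multiplying by a + b raises one exponent, and the mixed products drop to exponent k because ab =
    Q. *)
Lemma triple_term N k : (k < N)%N ->
  (a + b) * Q ^+ N * ((a ^+ k.+1 + b ^+ k.+1) * Q ^+ 'C(k.+1, 2)) =
  Q ^+ (N - k.+1) * ((a ^+ k.+2 + b ^+ k.+2) * Q ^+ 'C(k.+2, 2))
  + Q ^+ (N + k.+1) * ((a ^+ k + b ^+ k) * Q ^+ 'C(k, 2)).
Proof.
move=> ltkN; rewrite !bin2S.
have -> : Q ^+ (N + k.+1) = Q ^+ (N - k.+1) * Q ^+ k * Q ^+ k * Q * Q.
  by rewrite -!exprD -!exprSr; congr (_ ^+ _); lia.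
have -> : Q ^+ N = Q ^+ (N - k.+1) * Q ^+ k * Q.
  by rewrite -!exprD -!exprSr; congr (_ ^+ _); lia.
rewrite !exprD !exprS.
move: (Q ^+ (N - k.+1)) (Q ^+ k) (Q ^+ 'C(k, 2)) (a ^+ k) (b ^+ k) => x y z u v.
by rewrite -abQ; ring.
Qed.

(** Cauchy's finite form of the Jacobi triple product, with the terms of index k and -k paired. The
    N-th factor is 1 + Q^(2N+1) + (a + b) Q^N, and by [triple_term] its last summand shifts the
    index by one both ways, which is the recurrence of [gbin]. *)
Lemma finite_triple_product N :
  \prod_(j < N) ((1 + a * Q ^+ j) * (1 + b * Q ^+ j)) =
  gbin N 0 + \sum_(k < N) gbin N k.+1 * ((a ^+ k.+1 + b ^+ k.+1) * Q ^+ 'C(k.+1, 2)).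
Proof.
pose al k := (a ^+ k + b ^+ k) * Q ^+ 'C(k, 2).
have al0 : al 0%N = 2%:R by rewrite /al !expr0 mulr1.
have al1 : al 1%N = a + b by rewrite /al !expr1 mulr1.
rewrite -[RHS]/(gbin N 0 + \sum_(k < N) gbin N k.+1 * al k.+1).
elim: N => [|N IHN]; first by rewrite !big_ord0 addr0.
rewrite big_ord_recr /= IHN.
have -> : \sum_(k < N.+1) gbin N.+1 k.+1 * al k.+1 =
  (1 + Q ^+ (2 * N + 1)) * (\sum_(k < N.+1) gbin N k.+1 * al k.+1)
  + \sum_(k < N.+1) gbin N k * (Q ^+ (N - k) * al k.+1)
  + \sum_(k < N.+1) gbin N k.+2 * (Q ^+ (N + k.+2) * al k.+1).
  rewrite mulr_sumr -!big_split; apply: eq_bigr => k _ /=.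
  by rewrite -addnA addn2; ring.
rewrite -(gbin_sum_widen (fun k => al k.+1) (leqnSn N)).
rewrite big_ord_recl /= subn0 al1.
(* After the shift of index, the term k = 0 has to be taken out; it carries [al 0] = 2, the same 2
   as in the recurrence of [gbin N.+1 0]. *)
have -> : \sum_(k < N.+1) gbin N k.+2 * (Q ^+ (N + k.+2) * al k.+1) =
  \sum_(k < N) gbin N k.+1 * (Q ^+ (N + k.+1) * al k) - gbin N 1 * (Q ^+ (N + 1) * 2%:R).
  rewrite (gbin_sum_widen (fun k => Q ^+ (N + k.+1) * al k) (leqW (leqnSn N))).
  by rewrite [in RHS]big_ord_recl /= al0 addrAC subrr add0r.
have eab : (1 + a * Q ^+ N) * (1 + b * Q ^+ N) = 1 + Q ^+ (2 * N + 1) + (a + b) * Q ^+ N.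
  by rewrite exprD mul2n -addnn exprD; move: (Q ^+ N) => z; rewrite -abQ; ring.
rewrite eab mulrDr.
have -> : (gbin N 0 + \sum_(k < N) gbin N k.+1 * al k.+1) * ((a + b) * Q ^+ N) =
  gbin N 0 * ((a + b) * Q ^+ N) + (\sum_(k < N) gbin N k.+1 * (Q ^+ (N - k.+1) * al k.+2)
   + \sum_(k < N) gbin N k.+1 * (Q ^+ (N + k.+1) * al k)).
  rewrite mulrDl mulr_suml -big_split; congr (_ + _); apply: eq_bigr => k _ /=.
  rewrite -mulrDr -[X in _ = _ * X]triple_term //.
  by rewrite -/(al k.+1); move: (al _) (Q ^+ N) => x y; ring.
rewrite -[X in _ * (_ * (a + b)) + X]/(\sum_(k < N) gbin N k.+1 * (Q ^+ (N - k.+1) * al k.+2)).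
by rewrite !addn1; move: (\sum_(k < N) _) (\sum_(k < N) _) (\sum_(k < N) _) => x y z; ring.
Qed.
End FiniteTripleProduct.

(** * Lacunary series and the triple product *)

(* \sum_k c_k q^(e k), provided k <= e k for all k: the coefficient of q^n only
   collects the terms with k <= n. *)
Definition lacunary (c : nat -> int) (e : nat -> nat) : series :=
  Series (fun n => \sum_(k < n.+1) c k * (e k == n)%:R).

Lemma scoef_intM (c : int) (f : series) n : (c%:~R * f) n = c * f n.
Proof.
have pc : c%:~R = pol c%:P by rewrite -[c in RHS]intz !rmorph_int.
rewrite pc /= /fps_mul big_ord_recl /= coefC eqxx subn0 big1 ?addr0 // => i _.
by rewrite coefC mul0r.
Qed.

Lemma scoef_qn k n : (q ^+ k) n = (k == n)%:R.
Proof. by rewrite -pol_Xn /= coefXn eq_sym. Qed.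

Lemma eqmod_lacunary c e N M : (forall k, k <= e k)%N -> (N <= M)%N ->
  eqmod N (lacunary c e) (\sum_(k < M) (c k)%:~R * q ^+ e k).
Proof.
move=> le_e leNM n ltnN; rewrite scoef_sum [LHS]/=.
rewrite (big_ord_widen M (fun k => c k * (e k == n)%:R)); last exact: leq_trans leNM.
rewrite big_mkcond; apply: eq_bigr => k _.
rewrite scoef_intM scoef_qn; case: ltnP => // ltnk.
by rewrite (_ : _ == n = false) ?mulr0 //; have := le_e k; lia.
Qed.

Lemma lacunary_ext c e c' e' : c =1 c' -> e =1 e' -> lacunary c e = lacunary c' e'.
Proof. by move=> cc' ee'; apply: seriesP => n; apply: eq_bigr => k _; rewrite cc' ee'. Qed.

Lemma lacunary_shift c e : (forall k, k <= e k)%N ->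
  lacunary c e = (c 0%N)%:~R * q ^+ e 0%N + lacunary (fun k => c k.+1) (fun k => e k.+1).
Proof.
move=> le_e; apply: eqmodP => N.
apply: (eqmod_trans (eqmod_lacunary _ le_e (leqnSn N))); rewrite big_ord_recl.
apply: eqmodD => //; apply: eqmod_sym; apply: eqmod_lacunary => // k.
exact: leq_trans (le_e k.+1).
Qed.

Lemma lacunary_split m c e : (0 < m)%N -> (forall k, k <= e k)%N ->
  lacunary c e = \sum_(r < m) lacunary (fun k => c (r + m * k)%N) (fun k => e (r + m * k)%N).
Proof.
move=> m_gt0 le_e; apply: eqmodP => N.
apply: (eqmod_trans (eqmod_lacunary _ le_e (leq_pmull N m_gt0))).
rewrite (@big_ord_mul _ _ _ m N (fun k => (c k)%:~R * q ^+ e k)).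
apply: eqmod_sum => r _; apply: eqmod_sym; apply: eqmod_lacunary => // k.
by apply: leq_trans (le_e _); rewrite (leq_trans (leq_pmull k m_gt0)) // leq_addl.
Qed.

Lemma dilate_lacunary m c e : (forall k, k <= e k)%N ->
  dilate m.+1 (lacunary c e) = lacunary c (fun k => m.+1 * e k)%N.
Proof.
move=> le_e; apply: eqmodP => N; apply: (eqmodW (leq_pmull N (ltn0Sn m))).
apply: (eqmod_trans (eqmod_dilate (ltn0Sn m) (eqmod_lacunary c le_e (leq_pmull N (ltn0Sn m))))).
apply: eqmod_sym; apply: eqmod_trans (eqmod_lacunary _ _ (leqnn _)) _.
  by move=> k; apply: leq_trans (le_e k) (leq_pmull _ _).
rewrite rmorph_sum; apply: eqmod_eq; apply: eq_bigr => k _.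
by rewrite rmorphM rmorph_int rmorphXn /= dilate_q // -exprM.
Qed.

Lemma q_lacunary c e : (forall k, k <= e k)%N ->
  q * lacunary c e = lacunary c (fun k => (e k).+1).
Proof.
move=> le_e; apply: eqmodP => N.
apply: (eqmod_trans (eqmodM (@eqmod_refl N q) (eqmod_lacunary c le_e (leqnn N)))).
apply: eqmod_sym; apply: eqmod_trans (eqmod_lacunary _ _ (leqnn _)) _.
  by move=> k; apply: leqW.
rewrite mulr_sumr; apply: eqmod_eq; apply: eq_bigr => k _.
by rewrite exprS mulrCA.
Qed.

Lemma lacunaryN c e : - lacunary c e = lacunary (fun k => - c k) e.
Proof.
by apply: seriesP => n /=; rewrite -sumrN; apply: eq_bigr => k _; rewrite mulNr.
Qed.

Lemma eqmod_qfac A n : (0 < A)%N -> eqmod n (euler A) (qfac (q ^+ A) n).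
Proof.
move=> A0; apply: eqmod_trans (eqmod_qprod 1 A A0 (leqnn n)) _.
apply: eqmod_eq; apply: eq_bigr => j _.
by rewrite mul1r -exprM mulnS.
Qed.

(** The Gaussian binomial tends to 1/(Q;Q)_oo, because the three factorials in [gbinE] all tend to
    (Q;Q)_oo. The precision N - k decays with k. *)
Lemma eqmod_gbin A N k : (0 < A)%N -> (k <= N)%N ->
  eqmod (N - k) (euler A * gbin (q ^+ A) N k) 1.
Proof.
move=> A0 leN; have EA n : (N - k <= n)%N -> eqmod (N - k) (euler A) (qfac (q ^+ A) n).
  by move=> le; apply: eqmodW le _; apply: eqmod_qfac.
apply: (@eqmod_mulI _ (euler A)); rewrite ?euler0 // mulr1 mulrC [euler A * _]mulrC.
apply: (@eqmod_trans _ _ (gbin (q ^+ A) N k * qfac (q ^+ A) (N + k) * qfac (q ^+ A) (N - k))).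
  by apply: eqmodM; [apply: eqmodM => //|]; apply: EA; lia.
by rewrite gbinE //; apply: eqmod_sym; apply: EA; lia.
Qed.

(** The limit of the finite form at a = s q^B, b = s q^(A-B), where ab = q^A since s^2 = 1. *)
Theorem triple_product (s : int) (A B : nat) : s * s = 1 -> (0 < B < A)%N ->
  qprod (- s) B A * qprod (- s) (A - B) A * euler A =
  1 + lacunary (fun k => s ^+ k.+1) (fun k => A * 'C(k.+1, 2) + B * k.+1)%N
    + lacunary (fun k => s ^+ k.+1) (fun k => A * 'C(k.+1, 2) + (A - B) * k.+1)%N.
Proof.
move=> ss /andP[B0 ltBA]; have A0 : (0 < A)%N by lia.
have le_e C : (0 < C)%N -> forall k, (k <= A * 'C(k.+1, 2) + C * k.+1)%N.
  by move=> C0 k; apply: leq_trans (leq_addl _ _); case: C C0 => // C _; rewrite mulSn; lia.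
pose a : series := s%:~R * q ^+ B; pose b : series := s%:~R * q ^+ (A - B).
have abQ : a * b = q ^+ A.
  have -> : q ^+ A = q ^+ B * q ^+ (A - B) by rewrite -exprD subnKC // ltnW.
  have s1 : s%:~R * s%:~R = 1 :> series by rewrite -rmorphM /= ss.
  by rewrite -[RHS]mul1r -[X in _ = X * _]s1 /a /b mulrACA.
apply: eqmodP => N.
have prodE c C : c = s%:~R * q ^+ C ->
    eqmod N (qprod (- s) C A) (\prod_(j < N) (1 + c * (q ^+ A) ^+ j)).
  move=> ->; apply: eqmod_trans (eqmod_qprod _ _ A0 (leqnn _)) _.
  apply: eqmod_eq; apply: eq_bigr => j _.
  by rewrite -exprM exprD rmorphN /=; ring.
apply: (eqmod_trans (eqmodM (eqmodM (prodE a B erefl) (prodE b _ erefl))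
                            (@eqmod_refl N (euler A)))).
rewrite -big_split /= finite_triple_product // mulrC mulrDr mulr_sumr.
rewrite -addrA; apply: eqmodD.
  by have := @eqmod_gbin A N 0 A0 isT; rewrite subn0.
have AB0 : (0 < A - B)%N by rewrite subn_gt0.
apply: eqmod_sym; apply: (eqmod_trans (eqmodD
  (eqmod_lacunary _ (le_e B B0) (leqnn N)) (eqmod_lacunary _ (le_e _ AB0) (leqnn N)))).
rewrite -big_split /=; apply: eqmod_sum => k _; apply: eqmod_sym.
move: 'C(k.+1, 2) => m.
(* Since B and A - B are at least 1, a factor q^(k+1) splits off the term of index k + 1; it makes
   up for the precision N - (k+1) of [eqmod_gbin]. *)
pose al : series := s%:~R ^+ k.+1 * (q ^+ ((B - 1) * k.+1)
  + q ^+ ((A - B - 1) * k.+1)) * (q ^+ A) ^+ m.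
have -> : (s ^+ k.+1)%:~R * q ^+ (A * m + B * k.+1)
    + (s ^+ k.+1)%:~R * q ^+ (A * m + (A - B) * k.+1) = q ^+ k.+1 * (al * 1).
  rewrite /al.
  have -> : (B * k.+1 = k.+1 + (B - 1) * k.+1)%N by case: (B) B0 => // B' _;
    rewrite subn1 mulSn.
  have -> : ((A - B) * k.+1 = k.+1 + (A - B - 1) * k.+1)%N.
    by case: (A - B)%N AB0 => // C _; rewrite subn1 mulSn.
  rewrite rmorphXn /= !exprD -(exprM q A).
  move: (q ^+ (A * m)) (q ^+ k.+1) (q ^+ ((B - 1) * k.+1))
    (q ^+ ((A - B - 1) * k.+1)) (s%:~R ^+ k.+1) => x y z t v.
  by ring.
have -> : euler A * (gbin (q ^+ A) N k.+1 * ((a ^+ k.+1 + b ^+ k.+1) * (q ^+ A) ^+ m))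
   = q ^+ k.+1 * (al * (euler A * gbin (q ^+ A) N k.+1)).
  rewrite /al /a /b !exprMn -!exprM.
  have -> : (B * k.+1 = k.+1 + (B - 1) * k.+1)%N by case: (B) B0 => // B' _;
    rewrite subn1 mulSn.
  have -> : ((A - B) * k.+1 = k.+1 + (A - B - 1) * k.+1)%N.
    by case: (A - B)%N AB0 => // C _; rewrite subn1 mulSn.
  rewrite !exprD.
  move: (q ^+ (A * m)) (q ^+ k.+1) (q ^+ ((B - 1) * k.+1))
    (q ^+ ((A - B - 1) * k.+1)) (s%:~R ^+ k.+1) => x y z t v.
  by ring.
apply: eqmod_qnM; apply: eqmodM => //; apply: eqmod_gbin => //.
Qed.

(** * Theta functions and their 3-dissections *)

(* phi = \sum_n (-1)^n q^(n^2) = (q;q)^2/(q^2;q^2) is Ramanujan's phi(-q), and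
   psi = (q^2;q^2)^2/(q;q); so d2 has generating function 1/(phi^4 psi). *)
Definition phi : series :=
  1 + 2%:R * lacunary (fun k => (-1) ^+ k.+1) (fun k => k.+1 ^ 2)%N.
Definition psi : series := lacunary (fun=> 1) (fun k => 'C(k.+1, 2)).
(** This is the sum over all integers n of (-1)^n q^(3n^2-2n), and [psi1] is that of q^(n(3n-1)/2);
    positive and negative n are listed separately. *)
Definition phi1 : series :=
  1 + lacunary (fun k => (-1) ^+ k.+1) (fun k => 6 * 'C(k.+1, 2) + k.+1)%N
    + lacunary (fun k => (-1) ^+ k.+1) (fun k => 6 * 'C(k.+1, 2) + 5 * k.+1)%N.
Definition psi1 : series :=
  1 + lacunary (fun=> 1) (fun k => 3 * 'C(k.+1, 2) + k.+1)%N
    + lacunary (fun=> 1) (fun k => 3 * 'C(k.+1, 2) + 2 * k.+1)%N.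

Lemma bin2_double n : (2 * 'C(n.+1, 2) = n * n.+1)%N.
Proof. by elim: n => // n IHn; rewrite bin2S mulnDr IHn; ring. Qed.

Lemma leq_bin2 n : (n <= 'C(n.+1, 2))%N.
Proof. by case: n => // n; have := bin2_double n.+1; nia. Qed.

(** The squares n^2 are sorted by n mod 3: multiples of 3 give phi(q^9), and (3m+1)^2 and (3m-1)^2
    give phi1(q^3). *)
Lemma phi_dissection : phi = dilate 3 (dilate 3 phi) - 2%:R * q * dilate 3 phi1.
Proof.
pose L := lacunary (fun k => (-1) ^+ k.+1) (fun k => k.+1 ^ 2)%N.
pose O1 := lacunary (fun k => (-1) ^+ k.+1) (fun k => 6 * 'C(k.+1, 2) + k.+1)%N.
(* Indexed from k = 0, so it absorbs the constant term of [phi1]; with the factor q it collects the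
   squares (3k+1)^2. *)
pose O5 := lacunary (fun k => (-1) ^+ k) (fun k => 6 * 'C(k, 2) + 5 * k)%N.
have phi1E : phi1 = O1 + O5.
  have -> : O5 = 1 + lacunary (fun k => (-1) ^+ k.+1) (fun k => 6 * 'C(k.+1, 2) + 5 * k.+1)%N.
    by rewrite /O5 lacunary_shift ?mul1r // => k; lia.
  by rewrite /phi1 addrCA addrA.
have sE i m : (-1) ^+ (i + 3 * m) = (-1) ^+ (i + m) :> int.
  by rewrite [LHS]exprD exprM [RHS]exprD.
have LE : L = dilate 3 (dilate 3 L) - q * dilate 3 O5 - q * dilate 3 O1.
  rewrite /L /O1 /O5 !dilate_lacunary ?q_lacunary ?lacunaryN; try by move=> k; nia.
  rewrite {1}(@lacunary_split 3) //; last by move=> k; nia.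
  rewrite !big_ord_recr big_ord0 /= add0r addrC addrA.
  congr (_ + _ + _); apply: lacunary_ext => k.
  - by rewrite -addSn sE exprD ?exprS; ring.
  - nia.
  - by rewrite -addSn sE exprD ?exprS; ring.
  - by have := bin2_double k; case: k => [|k]; rewrite ?bin2S; nia.
  - by rewrite -addSn sE exprD ?exprS; ring.
  - by have := bin2_double k; nia.
by rewrite {1}/phi -/L LE /phi -/L phi1E !(rmorphD, rmorphM, rmorph1, rmorph_nat) /=; ring.
Qed.

Lemma euler_1_2 : euler 1 = qprod 1 1 2 * euler 2.
Proof. by rewrite {1}/euler (@qprod_split 2) // !big_ord_recr big_ord0 /= mul1r. Qed.

Lemma phi_prod : phi * euler 2 = euler 1 ^+ 2.
Proof.
have -> : phi = qprod 1 1 2 * qprod 1 1 2 * euler 2.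
  rewrite -[1 : int]opprK (@triple_product (-1) 2 1) // /phi.
  rewrite !(@lacunary_ext _ _ (fun k => (-1) ^+ k.+1) (fun k => k.+1 ^ 2)%N) //; first ring.
    by move=> k; have := bin2_double k; nia.
by rewrite euler_1_2; ring.
Qed.

Lemma phi1_prod : phi1 * (euler 2 * euler 3) = euler 1 * euler 6 ^+ 2.
Proof.
have -> : phi1 = qprod 1 1 6 * qprod 1 5 6 * euler 6.
  rewrite -[1 : int]opprK (@triple_product (-1) 6 1) // /phi1.
  by congr (1 + _ + _); apply: lacunary_ext => k //; rewrite mul1n.
have -> : euler 1 = qprod 1 1 6 * qprod 1 2 6 * qprod 1 3 6 * qprod 1 4 6 * qprod 1 5 6
  * euler 6.
  by rewrite {1}/euler (@qprod_split 6) // !big_ord_recr big_ord0 /= mul1r.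
have -> : euler 2 = qprod 1 2 6 * qprod 1 4 6 * euler 6.
  by rewrite {1}/euler (@qprod_split 3) // !big_ord_recr big_ord0 /= mul1r.
have -> : euler 3 = qprod 1 3 6 * euler 6.
  by rewrite {1}/euler (@qprod_split 2) // !big_ord_recr big_ord0 /= mul1r.
ring.
Qed.

(** Triangular numbers of even and odd index are the exponents 2n^2+n and 2n^2-n of the triple
    product with A = 4, B = 1; [qprod_sign] then removes the products with plus signs. *)
Lemma psi_prod : psi * euler 1 = euler 2 ^+ 2.
Proof.
have e : psi = qprod (-1) 1 4 * qprod (-1) 3 4 * euler 4.
  rewrite (@triple_product 1 4 1) // /psi (@lacunary_split 2) //; last exact: leq_bin2.
  rewrite !big_ord_recr big_ord0 /= add0r lacunary_shift; last first.
    by move=> k; apply: leq_trans (leq_bin2 _); lia.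
  rewrite [RHS]addrAC; congr (_ + _ + _); first by rewrite mul1r.
    apply: lacunary_ext => k; first by rewrite expr1n.
    by have := bin2_double k; have := bin2_double (0 + 2 * k.+1); nia.
  apply: lacunary_ext => k; first by rewrite expr1n.
  by have := bin2_double k; have := bin2_double (1 + 2 * k); nia.
have E1 : euler 1 = qprod 1 1 4 * qprod 1 2 4 * qprod 1 3 4 * euler 4.
  by rewrite {1}/euler (@qprod_split 4) // !big_ord_recr big_ord0 /= mul1r.
have E2 : euler 2 = qprod 1 2 4 * euler 4.
  by rewrite {1}/euler (@qprod_split 2) // !big_ord_recr big_ord0 /= mul1r.
have e2 : qprod 1 2 4 = qprod 1 2 8 * qprod 1 6 8.
  by rewrite (@qprod_split 2) // !big_ord_recr big_ord0 /= mul1r.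
have e3 : qprod (-1) 1 4 * qprod 1 1 4 = qprod 1 2 8 by rewrite qprod_sign.
have e4 : qprod (-1) 3 4 * qprod 1 3 4 = qprod 1 6 8 by rewrite qprod_sign.
transitivity ((qprod (-1) 1 4 * qprod 1 1 4) * (qprod (-1) 3 4 * qprod 1 3 4)
   * euler 4 * qprod 1 2 4 * euler 4); first by rewrite e E1; ring.
by rewrite e3 e4 -e2 E2; ring.
Qed.

Lemma psi1_prod : psi1 * (euler 1 * euler 6) = euler 2 * euler 3 ^+ 2.
Proof.
have e : psi1 = qprod (-1) 1 3 * qprod (-1) 2 3 * euler 3.
  rewrite (@triple_product 1 3 1) // /psi1.
  congr (1 + _ + _); apply: lacunary_ext => k; rewrite ?expr1n // mul1n //.
have E1 : euler 1 = qprod 1 1 3 * qprod 1 2 3 * euler 3.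
  by rewrite {1}/euler (@qprod_split 3) // !big_ord_recr big_ord0 /= mul1r.
have E2 : euler 2 = qprod 1 2 6 * qprod 1 4 6 * euler 6.
  by rewrite {1}/euler (@qprod_split 3) // !big_ord_recr big_ord0 /= mul1r.
have e3 : qprod (-1) 1 3 * qprod 1 1 3 = qprod 1 2 6 by rewrite qprod_sign.
have e4 : qprod (-1) 2 3 * qprod 1 2 3 = qprod 1 4 6 by rewrite qprod_sign.
by rewrite E2 -e3 -e4 e E1; ring.
Qed.

(** The triangular number of index 3k+1 is 9 times that of index k, plus 1; those of index 3k and
    3k+2 are 3 times the exponents of [psi1]. *)
Lemma psi_dissection : psi = dilate 3 psi1 + q * dilate 3 (dilate 3 psi).
Proof.
pose P2 := lacunary (fun=> 1) (fun k => 3 * 'C(k, 2) + 2 * k)%N.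
have psi1E : psi1 = lacunary (fun=> 1) (fun k => 3 * 'C(k.+1, 2) + k.+1)%N + P2.
  have -> : P2 = 1 + lacunary (fun=> 1) (fun k => 3 * 'C(k.+1, 2) + 2 * k.+1)%N.
    by rewrite /P2 lacunary_shift ?mul1r // => k; lia.
  by rewrite /psi1 addrCA addrA.
rewrite psi1E /P2 rmorphD /= /psi !dilate_lacunary ?q_lacunary; try by move=> k;
  have := leq_bin2 k; lia.
rewrite {1}(@lacunary_split 3) //; last exact: leq_bin2.
rewrite !big_ord_recr big_ord0 /= add0r addrC addrA.
congr (_ + _ + _); apply: lacunary_ext => k //.
- by have := bin2_double k; have := bin2_double (2 + 3 * k); nia.
- by have := bin2_double k; have := bin2_double (0 + 3 * k); rewrite !bin2S; nia.
- by have := bin2_double k; have := bin2_double (1 + 3 * k); nia.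
Qed.

Lemma phi0 : phi 0%N = 1.
Proof. by rewrite scoefD scoef_natM /= big_ord1 mulr0. Qed.

Lemma dilate_coef0 k f : dilate k f 0%N = f 0%N.
Proof. by rewrite /= dvdn0 div0n. Qed.

(** Both sides equal [euler 3 * euler 6]. *)
Lemma phi1_psi1 : phi1 * psi1 = dilate 3 phi * dilate 3 psi.
Proof.
have := phi1_prod; have := psi1_prod.
have : dilate 3 phi * euler 6 = euler 3 ^+ 2.
  by rewrite -[euler 6](dilate_euler 2 (k := 2)) // -[euler 3](dilate_euler 2 (k := 1))
    // -rmorphM phi_prod rmorphXn.
have : dilate 3 psi * euler 3 = euler 6 ^+ 2.
  by rewrite -[euler 6](dilate_euler 2 (k := 2)) // -[euler 3](dilate_euler 2 (k := 1))
    // -rmorphM psi_prod rmorphXn.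
move=> h1 h2 h3 h4.
apply: (@smulI (euler 1 * euler 2 * euler 3 * euler 6)); first by rewrite !smul_coef0 !euler0.
transitivity ((phi1 * (euler 2 * euler 3)) * (psi1 * (euler 1 * euler 6))); first by ring.
rewrite h3 h4.
transitivity ((dilate 3 phi * euler 6) * (dilate 3 psi * euler 3) * euler 1 * euler 2);
  last by ring.
by rewrite h1 h2; ring.
Qed.

(** The norm of phi is computed twice: from the dissection, and from phi = [euler 1 ^+ 2] /
    [euler 2], where [norm3_euler] gives phi^4/phi(q^3). *)
Lemma norm3_phi : (dilate 3 phi ^+ 3 - 8%:R * q * phi1 ^+ 3) * dilate 3 phi = phi ^+ 4.
Proof.
have -> : dilate 3 phi ^+ 3 - 8%:R * q * phi1 ^+ 3 = norm3 phi.
  have e : phi = dilate 3 (dilate 3 phi) + q * dilate 3 (- 2%:R * phi1) + q ^+ 2 * dilate 3 0.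
    by rewrite {1}phi_dissection rmorphM rmorphN rmorph_nat rmorph0 /=; ring.
  by rewrite [in RHS]e norm3_tri; ring.
have phi3 : dilate 3 phi * euler 6 = euler 3 ^+ 2.
  by rewrite -[euler 6](dilate_euler 2 (k := 2)) // -[euler 3](dilate_euler 2 (k := 1))
    // -rmorphM phi_prod rmorphXn.
have n1 := norm3_euler (k := 1) isT; have n2 := norm3_euler (k := 2) isT.
have := congr1 norm3 phi_prod; rewrite norm3M norm3X => n.
apply: (@smulI (euler 2 ^+ 4 * euler 6));
  first by rewrite smul_coef0 !exprS !smul_coef0 !euler0.
transitivity (norm3 phi * euler 2 ^+ 4 * (dilate 3 phi * euler 6)); first by ring.
rewrite phi3 -[X in _ * X * _]n2.
transitivity ((norm3 phi * norm3 (euler 2)) * euler 3 ^+ 2 * euler 6); first by ring.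
rewrite n.
transitivity ((norm3 (euler 1) * euler (3 * 1)) ^+ 2 * euler 6); first by ring.
rewrite n1.
transitivity ((phi * euler 2) ^+ 4 * euler 6); last by ring.
by rewrite phi_prod; ring.
Qed.

Lemma d2_phi_psi : Series d2 * (phi ^+ 4 * psi) = 1.
Proof.
have powE (f : series) k : Series (fps_pow f k) = f ^+ k.
  by elim: k => // k IHk; rewrite exprS -IHk.
have e1 : euler 1 = Series (qpoch 'X 'X) by rewrite /euler /qprod mul1r expr1.
have e2 : euler 2 = Series (qpoch 'X^2 'X^2) by rewrite /euler /qprod mul1r.
have D : Series d2 * euler 1 ^+ 7 = euler 2 ^+ 2.
  by rewrite e1 e2 -!powE; apply: seriesP => n; apply: d2_generating_function.
apply: (@smulI (euler 2 ^+ 4 * euler 1));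
  first by rewrite smul_coef0 !exprS !smul_coef0 !euler0.
transitivity (Series d2 * (phi * euler 2) ^+ 4 * (psi * euler 1)); first by ring.
rewrite phi_prod psi_prod.
transitivity (Series d2 * euler 1 ^+ 7 * (euler 1 * euler 2 ^+ 2)); first by ring.
by rewrite D; ring.
Qed.

(** * The functions u, x and w *)

(* u and x are locked because unification otherwise unfolds them, and series
   multiplication with them, down to coefficients. *)
Definition u : series := locked (q * dilate 3 phi1 * sinv phi).
Definition x : series := locked (q * phi1 ^+ 3 * dilate 3 phi * sinv phi ^+ 4).

Lemma phi_u : phi * u = q * dilate 3 phi1.
Proof. by rewrite /u -lock mulrCA [phi * _]mulrC sinvK ?mulr1 // phi0. Qed.

Lemma phi_x : phi ^+ 4 * x = q * phi1 ^+ 3 * dilate 3 phi.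
Proof. by rewrite /x -lock mulrCA -exprMn [phi * _]mulrC sinvK ?expr1n ?mulr1 // phi0. Qed.

Lemma phi_1p2u : phi * (1 + 2%:R * u) = dilate 3 (dilate 3 phi).
Proof.
transitivity (phi + 2%:R * (phi * u)); first by ring.
by rewrite phi_u {1}phi_dissection; ring.
Qed.

(** From (1 + 2u)^3 - 8u^3 = 1 + 6u + 12u^2. *)
Lemma phi_cubed_u : phi ^+ 3 * (1 + 6%:R * u + 12%:R * u ^+ 2) =
  dilate 3 (dilate 3 phi) ^+ 3 - 8%:R * q ^+ 3 * dilate 3 phi1 ^+ 3.
Proof.
transitivity ((phi * (1 + 2%:R * u)) ^+ 3 - 8%:R * (phi * u) ^+ 3); first by ring.
by rewrite phi_1p2u phi_u; ring.
Qed.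

Lemma dilate_norm3_phi : (dilate 3 (dilate 3 phi) ^+ 3 - 8%:R * q ^+ 3 * dilate 3 phi1 ^+ 3)
  * dilate 3 (dilate 3 phi)
  = dilate 3 phi ^+ 4.
Proof.
have := congr1 (dilate 3) norm3_phi.
by rewrite !(rmorphB, rmorphM, rmorphXn, rmorph_nat) /= dilate_q.
Qed.

Lemma scoef_coef0X (f : series) n : f 0%N = 1 -> (f ^+ n) 0%N = 1.
Proof. by move=> f0; elim: n => // n IHn; rewrite exprS smul_coef0 f0 IHn. Qed.

Lemma u_cubed : u ^+ 3 = dilate 3 x * (1 + 6%:R * u + 12%:R * u ^+ 2).
Proof.
apply: (@smulI (phi ^+ 3 * dilate 3 phi ^+ 4)).
  by rewrite smul_coef0 !scoef_coef0X ?dilate_coef0 ?phi0.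
transitivity ((phi * u) ^+ 3 * dilate 3 phi ^+ 4); first by ring.
transitivity (dilate 3 (phi ^+ 4 * x) * (phi ^+ 3 * (1 + 6%:R * u + 12%:R * u ^+ 2)));
  last first.
  by rewrite rmorphM rmorphXn /=; ring.
by rewrite phi_u phi_x phi_cubed_u -dilate_norm3_phi !(rmorphM, rmorphXn) /= dilate_q //; ring.
Qed.

(** By [norm3_phi], 8 phi^4 x = phi(q^3)^4 - phi^4, so 8x = (1 + 2u)(1 + 6u + 12u^2) - 1; the factor
    8 is then cancelled. *)
Lemma xE : x = u + 3%:R * u ^+ 2 + 3%:R * u ^+ 3.
Proof.
apply: (@series_natI 8) => //; apply: (@smulI (phi ^+ 4)).
  by rewrite scoef_coef0X ?phi0.
transitivity (8%:R * (phi ^+ 4 * x)); first by ring.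
transitivity (phi * (1 + 2%:R * u) * (phi ^+ 3 * (1 + 6%:R * u + 12%:R * u ^+ 2)) - phi ^+ 4);
  last by ring.
by rewrite phi_x phi_1p2u phi_cubed_u [dilate 3 (dilate 3 phi) * _]mulrC
  dilate_norm3_phi -norm3_phi; ring.
Qed.

Lemma u0 : u 0%N = 0.
Proof. by rewrite /u -lock -mulrA scoef_qM. Qed.

Definition w : series := locked (u * (1 + 2%:R * u) ^+ 4 * sinv (1 + 3%:R * u)).

Lemma coef0_1p3u : (1 + 3%:R * u) 0%N = 1.
Proof. by rewrite scoefD scoef_natM u0 mulr0. Qed.

Lemma wE : w * (1 + 3%:R * u) = u * (1 + 2%:R * u) ^+ 4.
Proof. by rewrite /w -lock -mulrA sinvK ?mulr1 // coef0_1p3u. Qed.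

Lemma psi_u : psi * u = q * dilate 3 (dilate 3 psi) * (1 + 3%:R * u).
Proof.
have Vphi1_psi1 : dilate 3 phi1 * dilate 3 psi1 =
  dilate 3 (dilate 3 phi) * dilate 3 (dilate 3 psi).
  by rewrite -[LHS]rmorphM phi1_psi1 rmorphM.
apply: (@smulI phi); first exact: phi0.
transitivity (psi * (phi * u)); first by ring.
transitivity (q * dilate 3 (dilate 3 psi) * (phi * (1 + 2%:R * u) + phi * u)); last by ring.
rewrite phi_1p2u phi_u.
transitivity (q * (dilate 3 phi1 * dilate 3 psi1)
  + q ^+ 2 * dilate 3 phi1 * dilate 3 (dilate 3 psi)).
  by rewrite {1}psi_dissection; ring.
by rewrite Vphi1_psi1; ring.
Qed.

(** D/D(q^9) is (1 + 2u)^4 psi(q^9)/psi, and [psi_u] expresses q psi(q^9)/psi as u/(1 + 3u). *)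
Lemma q_d2 : q * Series d2 = dilate 3 (dilate 3 (Series d2)) * w.
Proof.
have D := d2_phi_psi; have D9 := congr1 (fun f => dilate 3 (dilate 3 f)) D.
rewrite /= !(rmorphM, rmorphXn, rmorph1) /= in D9.
have psi0 : psi 0%N = 1 by rewrite /= big_ord1.
apply: (@smulI (phi ^+ 4 * psi * dilate 3 (dilate 3 phi) ^+ 4 * dilate 3 (dilate 3 psi)
  * (1 + 3%:R * u))).
  rewrite !smul_coef0 coef0_1p3u ?scoef_coef0X ?dilate_coef0 ?phi0 ?psi0 //.
transitivity ((Series d2 * (phi ^+ 4 * psi)) * dilate 3 (dilate 3 phi) ^+ 4
   * (q * dilate 3 (dilate 3 psi) * (1 + 3%:R * u))); first by ring.
transitivity ((dilate 3 (dilate 3 (Series d2)) * (dilate 3 (dilate 3 phi) ^+ 4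
  * dilate 3 (dilate 3 psi))) *
   (phi ^+ 4 * psi * (w * (1 + 3%:R * u)))); last by ring.
by rewrite D D9 wE -psi_u -phi_1p2u; ring.
Qed.

Definition Delta := dilate 3 phi ^+ 3 - 8%:R * q * phi1 ^+ 3.

(** The denominator of u is rationalised: with A = phi(q^9) and B = q phi1(q^3), phi = A - 2B
    divides A^3 - 8B^3, which is Delta(q^3). The sections of u and u^2 can then be read off. *)
Lemma u_Delta : dilate 3 Delta * u =
  q * dilate 3 phi1 * (dilate 3 (dilate 3 phi) ^+ 2
    + 2%:R * q * dilate 3 (dilate 3 phi) * dilate 3 phi1
                + 4%:R * q ^+ 2 * dilate 3 phi1 ^+ 2).
Proof.
apply: (@smulI phi); first exact: phi0.
transitivity (dilate 3 Delta * (phi * u)); first by ring.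
rewrite phi_u /Delta !(rmorphB, rmorphM, rmorphXn, rmorph_nat) /= dilate_q //.
by have := phi_dissection; move: (dilate 3 (dilate 3 phi)) => A ->; ring.
Qed.

Lemma Delta_phi : Delta * dilate 3 phi = phi ^+ 4. Proof. exact: norm3_phi. Qed.

Lemma sect0_u : sect 0 u = 4%:R * x.
Proof.
have : sect 0 (dilate 3 Delta * u) = 4%:R * q * phi1 ^+ 3.
  have -> : dilate 3 Delta * u = dilate 3 (4%:R * q * phi1 ^+ 3)
    + q * dilate 3 (dilate 3 phi ^+ 2 * phi1)
     + q ^+ 2 * dilate 3 (2%:R * dilate 3 phi * phi1 ^+ 2).
    by rewrite u_Delta !(rmorphM, rmorphXn, rmorph_nat) /= dilate_q //; ring.
  by rewrite sect_tri.
rewrite sect_dilateM => e; apply: (@smulI (phi ^+ 4)); first by rewrite scoef_coef0X ?phi0.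
transitivity (4%:R * (phi ^+ 4 * x)); last by ring.
transitivity (dilate 3 phi * (Delta * sect 0 u)); first by rewrite -Delta_phi; ring.
by rewrite e phi_x; ring.
Qed.

Lemma sect0_u2 : sect 0 (u ^+ 2) = 4%:R * x + 48%:R * x ^+ 2.
Proof.
have : sect 0 (dilate 3 (Delta ^+ 2) * u ^+ 2) =
    4%:R * q * dilate 3 phi ^+ 3 * phi1 ^+ 3 + 16%:R * q ^+ 2 * phi1 ^+ 6.
  have -> : dilate 3 (Delta ^+ 2) * u ^+ 2 =
      dilate 3 (4%:R * q * dilate 3 phi ^+ 3 * phi1 ^+ 3 + 16%:R * q ^+ 2 * phi1 ^+ 6)
      + q * dilate 3 (12%:R * q * dilate 3 phi ^+ 2 * phi1 ^+ 4)
      + q ^+ 2 * dilate 3 (dilate 3 phi ^+ 4 * phi1 ^+ 2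
        + 16%:R * q * dilate 3 phi * phi1 ^+ 5).
    transitivity ((dilate 3 Delta * u) ^+ 2); first by rewrite rmorphXn /=; ring.
    by rewrite u_Delta !(rmorphD, rmorphM, rmorphXn, rmorph_nat) /= dilate_q //; ring.
  by rewrite sect_tri.
rewrite sect_dilateM => e; apply: (@smulI (phi ^+ 4 * phi ^+ 4)).
  by rewrite smul_coef0 !scoef_coef0X ?phi0.
transitivity (4%:R * phi ^+ 4 * (phi ^+ 4 * x) + 48%:R * (phi ^+ 4 * x) ^+ 2); last by ring.
transitivity (dilate 3 phi ^+ 2 * (Delta ^+ 2 * sect 0 (u ^+ 2))); first by rewrite -Delta_phi;
  ring.
by rewrite e phi_x -Delta_phi /Delta; ring.
Qed.

Lemma sect0_1 : sect 0 1 = 1.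
Proof.
have -> : 1 = dilate 3 1 + q * dilate 3 0 + q ^+ 2 * dilate 3 0 by rewrite rmorph1 rmorph0;
  ring.
by rewrite sect_tri rmorph1 rmorph0; ring.
Qed.

Lemma sect0_quadratic a b c :
  sect 0 (dilate 3 a + dilate 3 b * u + dilate 3 c * u ^+ 2) =
  a + b * (4%:R * x) + c * (4%:R * x + 48%:R * x ^+ 2).
Proof.
by rewrite !sectD !sect_dilateM sect0_u sect0_u2 -[dilate 3 a]mulr1 sect_dilateM sect0_1 mulr1.
Qed.

(** Obtained by eliminating u between [xE] and [u_cubed]. The coefficient of x^2 is the trace of x,
    three times U_3(x) taken at q^3. *)
Lemma modular_equation (y := dilate 3 x) :
  x ^+ 3 = (57%:R * y + 1080%:R * y ^+ 2 + 5184%:R * y ^+ 3) * x ^+ 2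
         + (15%:R * y + 279%:R * y ^+ 2 + 1296%:R * y ^+ 3) * x
         + (y + 18%:R * y ^+ 2 + 81%:R * y ^+ 3).
Proof.
have u3 : u ^+ 3 = y * (1 + 6%:R * u + 12%:R * u ^+ 2) := u_cubed.
move: y u3 => y u3; rewrite xE; move: u u3 => u u3.
ring: u3.
Qed.

(** * The action of trisection on powers of x *)

(** All explicit polynomials have nonnegative coefficients, so their 3-adic bounds reduce to
    divisibility in [nat]. *)
Definition natpoly (s : seq nat) : {poly int} :=
  \poly_(i < size s) (nth 0%N s i)%:R.

Lemma coef_natpoly s i : (natpoly s)`_i = (nth 0%N s i)%:R.
Proof. by rewrite coef_poly; case: ltnP => // le; rewrite nth_default. Qed.

Lemma natpoly_nil : natpoly [::] = 0.
Proof. by apply/polyP => i; rewrite coef_natpoly nth_nil coef0. Qed.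

Lemma natpoly_cons n s : natpoly (n :: s) = n%:R + 'X * natpoly s.
Proof.
apply/polyP => i; rewrite coef_natpoly coefD coefXM -polyC_natr coefC.
by case: i => [|i] /=; rewrite ?addr0 // add0r coef_natpoly.
Qed.

Lemma dilate3D f g : dilate 3 (f + g) = dilate 3 f + dilate 3 g. Proof. exact: rmorphD. Qed.
Lemma dilate3M f g : dilate 3 (f * g) = dilate 3 f * dilate 3 g. Proof. exact: rmorphM. Qed.
Lemma dilate3X f n : dilate 3 (f ^+ n) = dilate 3 f ^+ n. Proof. exact: rmorphXn. Qed.
Lemma dilate3_nat n : dilate 3 n%:R = n%:R. Proof. exact: rmorph_nat. Qed.
Lemma dilate3_0 : dilate 3 0 = 0. Proof. exact: rmorph0. Qed.
Lemma dilate3_1 : dilate 3 1 = 1. Proof. exact: rmorph1. Qed.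
Definition dilate3E := (dilate3D, dilate3M, dilate3X, dilate3_nat, dilate3_0, dilate3_1).

Definition eval_x (p : {poly int}) : series := (map_poly intr p).[x].
HB.instance Definition _ :=
  GRing.RMorphism.copy eval_x (horner_eval x \o map_poly (intmul (1 : series))).

Lemma eval_xD p r : eval_x (p + r) = eval_x p + eval_x r. Proof. exact: rmorphD. Qed.
Lemma eval_xM p r : eval_x (p * r) = eval_x p * eval_x r. Proof. exact: rmorphM. Qed.

Lemma eval_x_X : eval_x 'X = x.
Proof. by rewrite /eval_x map_polyX hornerX. Qed.

Lemma eval_x_natpoly_cons n s : eval_x (natpoly (n :: s)) = n%:R + x * eval_x (natpoly s).
Proof. by rewrite natpoly_cons rmorphD rmorphM rmorph_nat /= eval_x_X. Qed.

Lemma eval_x_natpoly_nil : eval_x (natpoly [::]) = 0.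
Proof. by rewrite natpoly_nil rmorph0. Qed.

Lemma dilate3_eval_x_natpoly_cons n s :
  dilate 3 (eval_x (natpoly (n :: s))) = n%:R + dilate 3 x * dilate 3 (eval_x (natpoly s)).
Proof. by rewrite eval_x_natpoly_cons dilate3D dilate3M dilate3_nat. Qed.

Lemma dilate3_eval_x_natpoly_nil : dilate 3 (eval_x (natpoly [::])) = 0.
Proof. by rewrite eval_x_natpoly_nil dilate3_0. Qed.

Definition dilate3_eval_xE := (dilate3_eval_x_natpoly_cons, dilate3_eval_x_natpoly_nil).

Definition eval_xE := (eval_x_natpoly_cons, eval_x_natpoly_nil).

Lemma eval_xZ c p : eval_x (c *: p) = c%:~R * eval_x p.
Proof.
by rewrite -mul_polyC rmorphM /= {1}/eval_x map_polyC /= hornerC.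
Qed.

Lemma eval_x_sum p : eval_x p = \sum_(k < size p) (p`_k)%:~R * x ^+ k.
Proof.
rewrite -{1}[p]coefK poly_def rmorph_sum; apply: eq_bigr => k _.
by rewrite /= eval_xZ rmorphXn /= eval_x_X.
Qed.

(* The coefficients of modular_equation. *)
Definition modeq2 := natpoly [:: 0; 57; 1080; 5184]%N.
Definition modeq1 := natpoly [:: 0; 15; 279; 1296]%N.
Definition modeq0 := natpoly [:: 0; 1; 18; 81]%N.

Fixpoint mrec (p0 p1 p2 : {poly int}) (k : nat) : {poly int} :=
  if k is l.+1 then mrec p1 p2 (modeq2 * p2 + modeq1 * p1 + modeq0 * p0) l else p0.

Lemma mrecSSS p0 p1 p2 k : mrec p0 p1 p2 k.+3 =
  modeq2 * mrec p0 p1 p2 k.+2 + modeq1 * mrec p0 p1 p2 k.+1 + modeq0 * mrec p0 p1 p2 k.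
Proof. by elim: k p0 p1 p2 => // k IHk p0 p1 p2; apply: IHk. Qed.

(* Upol k is U_3(x^k) and Vpol k is (1 + 9 x) U_3(w x^k), as polynomials in x.
   The powers of 3 are split off because only the 3-adic valuations matter. *)
Definition Upol := mrec 1 (natpoly [:: 0; 3 ^ 0 * 19; 3 ^ 2 * (2 ^ 3 * 5); 3 ^ 3 * 2 ^ 6]%N)
  (natpoly [:: 0; 3 ^ 0 * 10; 3 ^ 3 * 47; 3 ^ 3 * (2 ^ 4 * 97); 3 ^ 4 * (2 ^ 6 * 113);
               3 ^ 6 * (2 ^ 10 * 5); 3 ^ 7 * 2 ^ 12]%N).

Definition Vpol := mrec
  (natpoly [:: 0; 3 ^ 1 * 11; 3 ^ 1 * (2 ^ 4 * 29); 3 ^ 1 * (2 ^ 7 * 55); 3 ^ 3 * (2 ^ 10 * 5);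
               3 ^ 4 * 2 ^ 12]%N)
  (natpoly [:: 0; 3 ^ 1 * 2 ^ 2; 3 ^ 1 * 775; 3 ^ 1 * (2 ^ 3 * 5045); 3 ^ 3 * (2 ^ 6 * 1687);
               3 ^ 4 * (2 ^ 11 * 229); 3 ^ 7 * (2 ^ 12 * 31); 3 ^ 8 * (2 ^ 15 * 5);
               3 ^ 8 * 2 ^ 18]%N)
  (natpoly [:: 0; 3 ^ 0 * 1; 3 ^ 0 * 1213; 3 ^ 0 * 176005; 3 ^ 2 * (2 ^ 9 * 2219);
    3 ^ 3 * (2 ^ 7 * 92233);
               3 ^ 6 * (2 ^ 11 * 4027); 3 ^ 6 * (2 ^ 12 * 24193); 3 ^ 9 * (2 ^ 16 * 433);
               3 ^ 9 * (2 ^ 18 * 523); 3 ^ 11 * (2 ^ 23 * 5); 3 ^ 12 * 2 ^ 24]%N).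

(** Multiply [modular_equation] by f x^k and apply U_3: by linearity its coefficients in x(q^3) come
    out as polynomials in x. *)
Lemma sect0_mrec (f : series) (p0 p1 p2 : {poly int}) :
  sect 0 f = eval_x p0 -> sect 0 (f * x) = eval_x p1 -> sect 0 (f * x ^+ 2) = eval_x p2 ->
  forall k, sect 0 (f * x ^+ k) = eval_x (mrec p0 p1 p2 k).
Proof.
move=> e0 e1 e2.
suff IH k : [/\ sect 0 (f * x ^+ k) = eval_x (mrec p0 p1 p2 k),
    sect 0 (f * x ^+ k.+1) = eval_x (mrec p0 p1 p2 k.+1)
  & sect 0 (f * x ^+ k.+2) = eval_x (mrec p0 p1 p2 k.+2)] by move=> k; case: (IH k).
elim: k => [|k [h0 h1 h2]]; first by rewrite expr0 mulr1 expr1.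
split=> //; rewrite mrecSSS !eval_xD !eval_xM -h0 -h1 -h2 -!sect_dilateM -!sectD.
congr (sect 0 _); rewrite (_ : f * x ^+ k.+3 = f * x ^+ k * x ^+ 3); last by rewrite !exprS;
  ring.
rewrite modular_equation !dilate3_eval_xE.
move: (dilate 3 x) => y; rewrite [x ^+ k.+2]exprS [x ^+ k.+1]exprS.
by move: (x ^+ k) => z; ring.
Qed.

(** The product is reduced to degree 2 in u by [u_cubed]: [c4] is the coefficient of u^4, and [c3]
    that of u^3 once u^4 is eliminated, both after U_3 has turned x(q^3) into x. *)
Lemma sect0_mul a0 a1 a2 b0 b1 b2 (c4 := a2 * b2)
    (c3 := a1 * b2 + a2 * b1 + 12%:R * x * c4) :
  sect 0 ((dilate 3 a0 + dilate 3 a1 * u + dilate 3 a2 * u ^+ 2) * (dilate 3 b0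
    + dilate 3 b1 * u + dilate 3 b2 * u ^+ 2)) =
  a0 * b0 + x * c3
  + (a0 * b1 + a1 * b0 + 6%:R * x * c3 + x * c4) * (4%:R * x)
  + (a0 * b2 + a1 * b1 + a2 * b0 + 12%:R * x * c3 + 6%:R * x * c4)
    * (4%:R * x + 48%:R * x ^+ 2).
Proof.
rewrite -sect0_quadratic; congr (sect 0 _).
rewrite {}/c3 {}/c4 !dilate3E; have := u_cubed.
move: (dilate 3 a0) (dilate 3 a1) (dilate 3 a2) (dilate 3 b0) (dilate 3 b1) (dilate 3 b2)
  (dilate 3 x) u.
move=> ? ? ? ? ? ? ? ? h; ring: h.
Qed.

Lemma x_quadratic : x = dilate 3 (eval_x (natpoly [:: 0; 3]%N))
  + dilate 3 (eval_x (natpoly [:: 1; 18]%N)) * u + dilate 3 (eval_x (natpoly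
    [:: 3; 36]%N)) * u ^+ 2.
Proof. by rewrite !dilate3_eval_xE {1}xE u_cubed; ring. Qed.

Lemma x2_quadratic : x ^+ 2 = dilate 3 (eval_x (natpoly [:: 0; 6; 297; 3888; 15552]%N))
  + dilate 3 (eval_x (natpoly [:: 0; 51; 2052; 24624; 93312]%N)) * u
  + dilate 3 (eval_x (natpoly [:: 1; 180; 5292; 54432; 186624]%N)) * u ^+ 2.
Proof.
have h := u_cubed; rewrite !dilate3_eval_xE {1}xE; move: (dilate 3 x) u h => y v h.
ring: h.
Qed.

Lemma w_quadratic : w * (1 + 9%:R * dilate 3 x) =
  dilate 3 (eval_x (natpoly [:: 0; 9; 144; 576]%N))
  + dilate 3 (eval_x (natpoly [:: 1; 68; 912; 3456]%N)) * u
  + dilate 3 (eval_x (natpoly [:: 5; 184; 2016; 6912]%N)) * u ^+ 2.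
Proof.
have h := u_cubed; have hw := wE; rewrite !dilate3_eval_xE.
move: (dilate 3 x) u w h hw => y v z h hw.
(* 1 + 9y is the constant term, up to sign, of a monic cubic for 1 + 3u over Z[y], so the second
   factor clears the denominator of w. *)
have -> : 1 + 9%:R * y = (1 + 3%:R * v) *
    ((1 + 3%:R * v) ^+ 2 - (3%:R + 36%:R * y) * (1 + 3%:R * v) + 3%:R + 18%:R * y).
  by ring: h.
by rewrite mulrA hw; ring: h.
Qed.

Lemma sect0_x k : sect 0 (x ^+ k) = eval_x (Upol k).
Proof.
rewrite -[x ^+ k]mul1r; apply: sect0_mrec; rewrite ?mul1r.
- by rewrite rmorph1 sect0_1.
- by rewrite {1}x_quadratic sect0_quadratic !eval_xE; ring.
- by rewrite {1}x2_quadratic sect0_quadratic !eval_xE; ring.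
Qed.

Lemma sect0_wx k : sect 0 (w * (1 + 9%:R * dilate 3 x) * x ^+ k) = eval_x (Vpol k).
Proof.
apply: sect0_mrec; rewrite w_quadratic.
- by rewrite sect0_quadratic !eval_xE; ring.
- by rewrite {1}x_quadratic sect0_mul !eval_xE; ring.
- by rewrite x2_quadratic sect0_mul !eval_xE; ring.
Qed.

(** * 3-adic valuations of coefficients *)

(* Bounds the valuations as if x had size 3^(-3/2), hence u size 3^(-1/2), with
   a loss of c/2. *)
Definition wt (c : nat) (p : {poly int}) :=
  forall j, (3%:Z ^+ ((3 * j - c)./2) %| p`_j)%Z.

Lemma dvd3_leq m n (z : int) : (m <= n)%N -> (3%:Z ^+ n %| z)%Z -> (3%:Z ^+ m %| z)%Z.
Proof. by move=> le; apply: dvdz_trans; apply: dvdz_exp2l. Qed.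

Lemma wtD c p r : wt c p -> wt c r -> wt c (p + r).
Proof. by move=> hp hr j; rewrite coefD rpredD. Qed.

Definition dvd3s (g : nat -> nat) (s : seq nat) :=
  forall j, (3 ^ g j %| nth 0 s j)%N.

Lemma dvd3s_nil g : dvd3s g [::].
Proof. by move=> j; rewrite nth_nil dvdn0. Qed.

Lemma dvd3s_cons g n s :
  (3 ^ g 0 %| n)%N -> dvd3s (fun j => g j.+1) s -> dvd3s g (n :: s).
Proof. by move=> hn hs [|j] //; apply: hs. Qed.

Lemma dvd3_mul e v m : (e <= v)%N -> (3 ^ e %| 3 ^ v * m)%N.
Proof. by move=> le; apply/dvdn_mulr/dvdn_exp2l. Qed.

Lemma dvd3_natpoly g s j : dvd3s g s -> (3%:Z ^+ g j %| (natpoly s)`_j)%Z.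
Proof. by move=> h; rewrite coef_natpoly natz dvdzE abszX; apply: h. Qed.

Lemma wt_natpoly c s : dvd3s (fun j => (3 * j - c)./2) s -> wt c (natpoly s).
Proof. by move=> h j; apply: (@dvd3_natpoly (fun j => (3 * j - c)./2)). Qed.

Ltac prove_dvd3s := apply: (dvd3s_cons (dvdn0 _));
  repeat (apply: dvd3s_cons; [apply: dvd3_mul; exact: isT|]);
  exact: dvd3s_nil.

Lemma coef_natrM n (p : {poly int}) j : (n%:R * p)`_j = n%:R * p`_j.
Proof. by rewrite -polyC_natr coefCM. Qed.

Lemma wt_natrM e c d n p : (3 ^ e %| n)%N -> (c <= d + 2 * e)%N -> wt c p -> wt d (n%:R * p).
Proof.
move=> /dvdnP[k ->] le hp j; rewrite coef_natrM natrM natrX [3%:R]natz -mulrA.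
apply: dvdz_mull; apply: (@dvd3_leq _ ((3 * j - c)./2 + e)); first by lia.
by rewrite addnC exprD dvdz_mul ?dvdzz ?hp.
Qed.

Lemma wt_XM c p : wt c p -> wt (c + 3) ('X * p).
Proof.
move=> hp j; rewrite coefXM; case: j => [|j] /=; first by rewrite dvdz0.
by apply: dvd3_leq (hp j); lia.
Qed.

(** A term 3^e x^i costs 3i - 2e in weight. This is at most 1, 2, 3 in [modeq2], [modeq1], [modeq0],
    so the weight grows by at most 1 per step. *)
Lemma wt_mrec c p0 p1 p2 : wt c p0 -> wt c.+1 p1 -> wt c.+2 p2 ->
  forall k, wt (k + c) (mrec p0 p1 p2 k).
Proof.
move=> w0 w1 w2; suff IH k : [/\ wt (k + c) (mrec p0 p1 p2 k),
    wt (k.+1 + c) (mrec p0 p1 p2 k.+1) & wt (k.+2 + c) (mrec p0 p1 p2 k.+2)].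
  by move=> k; case: (IH k).
elim: k => // k [h0 h1 h2]; split=> //; rewrite mrecSSS.
rewrite /modeq2 /modeq1 /modeq0 !natpoly_cons natpoly_nil mulr0 !addr0.
move: (mrec _ _ _ k) (mrec _ _ _ k.+1) (mrec _ _ _ k.+2) h0 h1 h2 => r0 r1 r2 h0 h1 h2.
have E b c' d (r : {poly int}) :
    (0%:R + 'X * (b%:R + 'X * (c'%:R + 'X * d%:R))) * r =
    b%:R * ('X * r) + c'%:R * ('X * ('X * r)) + d%:R * ('X * ('X * ('X * r))).
  by ring.
rewrite !E.
have X1 c' p : wt c' p -> wt (c' + 3) ('X * p) := @wt_XM c' p.
have X2 c' p : wt c' p -> wt (c' + 3 + 3) ('X * ('X * p)) by move/X1/X1.
have X3 c' p : wt c' p -> wt (c' + 3 + 3 + 3) ('X * ('X * ('X * p))) by move/X1/X1/X1.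
do ![apply: wtD].
- by apply: (@wt_natrM 1 _ _ 57) (X1 _ _ h2) => //; lia.
- by apply: (@wt_natrM 3 _ _ 1080) (X2 _ _ h2) => //; lia.
- by apply: (@wt_natrM 4 _ _ 5184) (X3 _ _ h2) => //; lia.
- by apply: (@wt_natrM 1 _ _ 15) (X1 _ _ h1) => //; lia.
- by apply: (@wt_natrM 2 _ _ 279) (X2 _ _ h1) => //; lia.
- by apply: (@wt_natrM 4 _ _ 1296) (X3 _ _ h1) => //; lia.
- by apply: (@wt_natrM 0 _ _ 1) (X1 _ _ h0) => //; lia.
- by apply: (@wt_natrM 2 _ _ 18) (X2 _ _ h0) => //; lia.
- by apply: (@wt_natrM 4 _ _ 81) (X3 _ _ h0) => //; lia.
Qed.

Lemma wt_Upol k : wt (k + 1) (Upol k).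
Proof.
apply: wt_mrec.
- by move=> j; rewrite coef1; case: j => [|j]; rewrite ?dvdz0.
- by apply: wt_natpoly; prove_dvd3s.
- by apply: wt_natpoly; prove_dvd3s.
Qed.

Lemma wt_Vpol k : wt (k + 6) (Vpol k).
Proof.
apply: wt_mrec.
- by apply: wt_natpoly; prove_dvd3s.
- by apply: wt_natpoly; prove_dvd3s.
- by apply: wt_natpoly; prove_dvd3s.
Qed.

(** * Linear maps on polynomials in x and the two modules *)

Definition comb (t : nat -> {poly int}) (p : {poly int}) : {poly int} :=
  \sum_(k < size p) p`_k *: t k.

(** [comb t] is the linear map x^k -> [t k]. The first three terms are separated because [good_even]
    bounds only the coefficients from index 4 on. *)
Lemma coef_comb (t : nat -> {poly int}) (p : {poly int}) j : p`_0 = 0 -> (comb t p)`_j =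
  p`_1 * (t 1%N)`_j + p`_2 * (t 2%N)`_j + p`_3 * (t 3%N)`_j
  + \sum_(k < size p) p`_(k + 4) * (t (k + 4)%N)`_j.
Proof.
move=> p0; rewrite /comb coef_sum.
under eq_bigr => k _ do rewrite coefZ.
rewrite (big_ord_widen (4 + size p) (fun k => p`_k * (t k)`_j)) ?leq_addl //.
rewrite big_mkcond /= (eq_bigr (fun k : 'I_(4 + size p) => p`_k * (t k)`_j)).
  rewrite !big_ord_recl p0 mul0r add0r /= !addrA; congr (_ + _).
  by apply: eq_bigr => k _; rewrite addn4.
by move=> k _; case: ltnP => // le; rewrite nth_default ?mul0r.
Qed.

(* Since the coefficients of x in U_3(x), U_3(x^2), U_3(x^3) are 19, 10, 1, all
   congruent to 1 mod 9, the extra condition in good_odd makes U_3 divisible by 9. *)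
Definition good_even (p : {poly int}) :=
  p`_0 = 0 /\ forall k, (4 <= k)%N -> (3%:Z ^+ (k - 2) %| p`_k)%Z.
Definition good_odd (p : {poly int}) := good_even p /\ (9 %| p`_1 + p`_2 + p`_3)%Z.

(** Raising k by one gains a power of 3 in p_k and loses at most one in [t k], so k = 4 is the worst
    case. *)
Lemma dvd_comb_tail (t : nat -> {poly int}) c (p : {poly int}) j m :
  (forall k, wt (k + c) (t k)) -> good_even p ->
  (forall k, (4 <= k)%N -> (m <= k - 2 + (3 * j - (k + c))./2)%N) ->
  (3%:Z ^+ m %| \sum_(k < size p) p`_(k + 4) * (t (k + 4)%N)`_j)%Z.
Proof.
move=> wt_t [_ Mp] le_m; apply: rpred_sum => k _.
apply: (dvd3_leq (le_m (k + 4)%N (leq_addl _ _))).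
by rewrite exprD; apply: dvdz_mul; [apply: Mp; rewrite leq_addl|apply: wt_t].
Qed.

Lemma dvd_comb (t : nat -> {poly int}) c (p : {poly int}) j m :
  (forall k, wt (k + c) (t k)) -> good_even p ->
  (forall k, (4 <= k)%N -> (m <= k - 2 + (3 * j - (k + c))./2)%N) ->
  (3%:Z ^+ m %| (t 1%N)`_j)%Z -> (3%:Z ^+ m %| (t 2%N)`_j)%Z ->
  (3%:Z ^+ m %| (t 3%N)`_j)%Z -> (3%:Z ^+ m %| (comb t p)`_j)%Z.
Proof.
move=> wt_t Mp le_m d1 d2 d3; rewrite coef_comb; last by case: Mp.
by rewrite !rpredD ?(dvd_comb_tail wt_t Mp le_m) //; apply: dvdz_mull.
Qed.

Lemma coef_step a b c (p : {poly int}) (r := natpoly [:: 0; a; b; c]%N * p) :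
  [/\ r`_0 = 0, r`_1 = a%:R * p`_0, r`_2 = a%:R * p`_1 + b%:R * p`_0,
      r`_3 = a%:R * p`_2 + b%:R * p`_1 + c%:R * p`_0
    & r`_4 = a%:R * p`_3 + b%:R * p`_2 + c%:R * p`_1].
Proof.
have -> : r = a%:R * ('X * p) + b%:R * ('X * ('X * p)) + c%:R * ('X * ('X * ('X * p))).
  by rewrite /r !natpoly_cons natpoly_nil; ring.
by split; rewrite !coefD !coef_natrM !coefXM /= ?mulr0 ?addr0.
Qed.

Definition rec3 (t : nat -> {poly int}) :=
  forall k, t k.+3 = modeq2 * t k.+2 + modeq1 * t k.+1 + modeq0 * t k.

(** For some low coefficients the bounds of [wt] are too weak, so these are computed exactly. *)
Lemma rec3_coef (t : nat -> {poly int}) k : rec3 t ->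
  [/\ (t k.+3)`_0 = 0,
      (t k.+3)`_1 = 57%:R * (t k.+2)`_0 + 15%:R * (t k.+1)`_0 + 1%:R * (t k)`_0,
      (t k.+3)`_2 = (57%:R * (t k.+2)`_1 + 1080%:R * (t k.+2)`_0)
        + (15%:R * (t k.+1)`_1 + 279%:R * (t k.+1)`_0)
        + (1%:R * (t k)`_1 + 18%:R * (t k)`_0),
      (t k.+3)`_3 = (57%:R * (t k.+2)`_2 + 1080%:R * (t k.+2)`_1 + 5184%:R * (t k.+2)`_0)
        + (15%:R * (t k.+1)`_2 + 279%:R * (t k.+1)`_1 + 1296%:R * (t k.+1)`_0)
        + (1%:R * (t k)`_2 + 18%:R * (t k)`_1 + 81%:R * (t k)`_0)
    & (t k.+3)`_4 = (57%:R * (t k.+2)`_3 + 1080%:R * (t k.+2)`_2 + 5184%:R * (t k.+2)`_1)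
        + (15%:R * (t k.+1)`_3 + 279%:R * (t k.+1)`_2 + 1296%:R * (t k.+1)`_1)
        + (1%:R * (t k)`_3 + 18%:R * (t k)`_2 + 81%:R * (t k)`_1)].
Proof.
move=> ->; rewrite !coefD /modeq2 /modeq1 /modeq0.
have [-> -> -> -> ->] := coef_step 57 1080 5184 (t k.+2).
have [-> -> -> -> ->] := coef_step 15 279 1296 (t k.+1).
have [-> -> -> -> ->] := coef_step 1 18 81 (t k).
by split=> //; rewrite !addr0.
Qed.

Lemma mrec_coef0 (p0 p1 p2 : {poly int}) k :
  p1`_0 = 0 -> p2`_0 = 0 -> (mrec p0 p1 p2 k.+1)`_0 = 0.
Proof.
move=> h1 h2; case: k => [|[|k]] //.
by have [-> _ _ _ _] := rec3_coef k (mrecSSS p0 p1 p2).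
Qed.

Lemma comb_coef0 (t : nat -> {poly int}) (p : {poly int}) :
  p`_0 = 0 -> (forall k, (t k.+1)`_0 = 0) -> (comb t p)`_0 = 0.
Proof.
move=> p0 t0; rewrite coef_comb // !t0 !mulr0 !add0r big1 // => k _.
by rewrite addn4 t0 mulr0.
Qed.

Lemma Upol_coef0 k : (Upol k.+1)`_0 = 0.
Proof. by apply: mrec_coef0; rewrite coef_natpoly. Qed.

Lemma Vpol_coef0 k : (Vpol k)`_0 = 0.
Proof.
by case: k => [|k]; [rewrite coef_natpoly | apply: mrec_coef0; rewrite coef_natpoly].
Qed.

Lemma divide_poly (m : int) (p : {poly int}) :
  (forall j, (m %| p`_j)%Z) -> exists r, p = m *: r.
Proof.
move=> mp; exists (\poly_(j < size p) (p`_j %/ m)%Z); apply/polyP => j.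
rewrite coefZ coef_poly; case: ltnP => le; first by rewrite mulrC divzK.
by rewrite mulr0 nth_default.
Qed.

Lemma comb_Upol p : good_odd p -> exists r, good_even r /\ comb Upol p = 9 *: r.
Proof.
case=> Mp sum9; have p0 := Mp.1.
(* From degree 4 on the image is divisible by 3^j, which leaves 3^(j-2) after division by 9. *)
have dT j m : (4 <= j)%N -> (m <= j)%N -> (3%:Z ^+ m %| (comb Upol p)`_j)%Z.
  move=> j4 mj; apply: (dvd_comb wt_Upol Mp); first by move=> k; lia.
  - by apply: dvd3_leq (wt_Upol 1 j); lia.
  - by apply: dvd3_leq (wt_Upol 2 j); lia.
  - by apply: dvd3_leq (wt_Upol 3 j); lia.
have T11 : (Upol 1)`_1 = 19%:R := coef_natpoly _ 1.
have T21 : (Upol 2)`_1 = 10%:R := coef_natpoly _ 1.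
have [_ T31 T32 _ _] := rec3_coef 0 (mrecSSS _ _ _ : rec3 Upol).
rewrite !Upol_coef0 coef1 in T31; rewrite !Upol_coef0 T11 T21 !coef1 in T32.
have d22 : (9 %| (Upol 2)`_2)%Z.
  by rewrite (coef_natpoly _ 2 : (Upol 2)`_2 = (3 ^ 3 * 47)%:R).
have d32 : (9 %| (Upol 3)`_2)%Z.
  (* The value is 57 * 10 + 15 * 19 + 18 = 873. *)
  by rewrite T32 [X in (_ %| X)%Z](_ : _ = 9 * 97%:R) ?dvdz_mulr //; ring.
have {}T31 : (Upol 3)`_1 = 1 by rewrite T31 !mulr0 !add0r mulr1.
have d9 j : (9 %| (comb Upol p)`_j)%Z.
  case: j => [|[|[|[|j]]]].
  - by rewrite comb_coef0 //; apply: Upol_coef0.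
  - rewrite coef_comb // T11 T21 T31.
    rewrite rpredD //; last by apply: (@dvd_comb_tail _ 1 _ _ 2) => //; [exact: wt_Upol|lia].
    have -> : p`_1 * 19%:R + p`_2 * 10%:R + p`_3 * 1 =
      p`_1 + p`_2 + p`_3 + 9 * (2%:R * p`_1 + p`_2) by ring.
    by rewrite rpredD // dvdz_mulr.
  - apply: (@dvd_comb _ 1 _ _ 2) => //; [exact: wt_Upol|lia|exact: (wt_Upol 1 2)].
  - apply: (@dvd_comb _ 1 _ _ 2) => //; [exact: wt_Upol|lia|..].
    + by apply: dvd3_leq (wt_Upol 1 3).
    + by apply: dvd3_leq (wt_Upol 2 3).
    + by apply: dvd3_leq (wt_Upol 3 3).
  - exact: (dT j.+4 2%N).
have [r er] := divide_poly d9; exists r; split=> //; split.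
  have := comb_coef0 p0 Upol_coef0; rewrite er coefZ => /eqP.
  by rewrite mulf_eq0 => /orP[|/eqP].
move=> k k4; have := dT k k k4 (leqnn k); rewrite er coefZ.
have -> : 3%:Z ^+ k = 9 * 3%:Z ^+ (k - 2) by rewrite -(@subnKC 2 k) 1?exprD ?addKn //; lia.
by rewrite dvdz_mul2l.
Qed.

Lemma dvdz_witness (d c z : int) : z = d * c -> (d %| z)%Z.
Proof. by move->; apply: dvdz_mulr. Qed.

(** The first three claims give the congruence of [good_odd] for any p_1, p_2, p_3. In the last one
    [wt_Vpol] yields only a single factor 3. *)
Lemma Vpol_low_coef :
  [/\ (9 %| (Vpol 1)`_1 + (Vpol 1)`_2 + (Vpol 1)`_3)%Z,
      (9 %| (Vpol 2)`_1 + (Vpol 2)`_2 + (Vpol 2)`_3)%Z,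
      (9 %| (Vpol 3)`_1 + (Vpol 3)`_2 + (Vpol 3)`_3)%Z & (9 %| (Vpol 3)`_4)%Z].
Proof.
have B11 : (Vpol 1)`_1 = (3 ^ 1 * 2 ^ 2)%:R := coef_natpoly _ 1.
have B12 : (Vpol 1)`_2 = (3 ^ 1 * 775)%:R := coef_natpoly _ 2.
have B13 : (Vpol 1)`_3 = (3 ^ 1 * (2 ^ 3 * 5045))%:R := coef_natpoly _ 3.
have B21 : (Vpol 2)`_1 = 1%:R := coef_natpoly _ 1.
have B22 : (Vpol 2)`_2 = (3 ^ 0 * 1213)%:R := coef_natpoly _ 2.
have B23 : (Vpol 2)`_3 = (3 ^ 0 * 176005)%:R := coef_natpoly _ 3.
have B01 : (Vpol 0)`_1 = (3 ^ 1 * 11)%:R := coef_natpoly _ 1.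
have B02 : (Vpol 0)`_2 = (3 ^ 1 * (2 ^ 4 * 29))%:R := coef_natpoly _ 2.
have B03 : (Vpol 0)`_3 = (3 ^ 1 * (2 ^ 7 * 55))%:R := coef_natpoly _ 3.
have [_ B31 B32 B33 B34] := rec3_coef 0 (mrecSSS _ _ _ : rec3 Vpol).
rewrite !Vpol_coef0 in B31; rewrite !Vpol_coef0 B21 B11 B01 in B32.
rewrite !Vpol_coef0 B21 B11 B01 B22 B12 B02 in B33.
rewrite B21 B11 B01 B22 B12 B02 B23 B13 B03 in B34.
rewrite B31 B32 B33 B34 B11 B12 B13 B21 B22 B23; split.
- by apply: (@dvdz_witness _ 13713%:R); ring.
- by apply: (@dvdz_witness _ 19691%:R); ring.
- by apply: (@dvdz_witness _ 12300%:R); ring.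
- by apply: (@dvdz_witness _ 1541865%:R); ring.
Qed.

Lemma comb_Vpol p : good_even p -> good_odd (comb Vpol p).
Proof.
move=> Mp; have p0 := Mp.1; have [d1 d2 d3 d34] := Vpol_low_coef.
split; first split.
- exact: (comb_coef0 p0 (fun k => Vpol_coef0 k.+1)).
- move=> j j4; apply: (dvd_comb wt_Vpol Mp); first by move=> k; lia.
  + by apply: dvd3_leq (wt_Vpol 1 j); lia.
  + by apply: dvd3_leq (wt_Vpol 2 j); lia.
  + have [->|] := eqVneq j 4%N; first exact: d34.
    by move=> neq; apply: dvd3_leq (wt_Vpol 3 j); lia.
(* For k >= 4 the coefficient p_k alone is divisible by 9. *)
- have tail j : (9 %| \sum_(k < size p) p`_(k + 4) * (Vpol (k + 4)%N)`_j)%Z.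
    by apply: (dvd_comb_tail (m := 2) wt_Vpol Mp) => k; lia.
  rewrite !coef_comb //; move: (tail 1%N) (tail 2%N) (tail 3%N) d1 d2 d3 => {tail d34}.
  move: (\sum_(k < _) _) (\sum_(k < _) _) (\sum_(k < _) _) => s1 s2 s3.
  move: (Vpol 1) (Vpol 2) (Vpol 3) => b1 b2 b3 ds1 ds2 ds3 d1 d2 d3.
  rewrite [X in (_ %| X)%Z](_ : _ = s1 + s2 + s3 + (p`_1 * (b1`_1 + b1`_2 + b1`_3)
    + p`_2 * (b2`_1 + b2`_2 + b2`_3) + p`_3 * (b3`_1 + b3`_2 + b3`_3))); last by ring.
  by rewrite !rpredD // dvdz_mull.
Qed.

(** The starting value U_3(w) supplies the first factor 3 of the final exponent. *)
Lemma Vpol0 : exists r, good_odd r /\ Vpol 0 = 3 *: r.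
Proof.
pose s := [:: 0; 3 ^ 0 * 11; 3 ^ 0 * (2 ^ 4 * 29); 3 ^ 0 * (2 ^ 7 * 55);
              3 ^ 2 * (2 ^ 10 * 5); 3 ^ 3 * 2 ^ 12]%N.
have c1 : (natpoly s)`_1 = 11%:R := coef_natpoly _ 1.
have c2 : (natpoly s)`_2 = 464%:R := coef_natpoly _ 2.
have c3 : (natpoly s)`_3 = 7040%:R := coef_natpoly _ 3.
exists (natpoly s); split; last first.
  rewrite -mul_polyC -[3 : int]natz polyC_natr /s /Vpol /= !natpoly_cons natpoly_nil; ring.
split; last by rewrite c1 c2 c3.
split=> [|k k4]; first by rewrite coef_natpoly.
have := @dvd3_natpoly (fun j => if (j < 4)%N then 0%N else (j - 2)%N) s k.
by rewrite ltnNge k4; apply; rewrite /s; prove_dvd3s.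
Qed.

(** * The congruence *)

(** Membership modulo 3^R, since 1/(1 + 9x) is a power series in x and not a polynomial. *)
Definition represented (M : {poly int} -> Prop) (R : nat) (f : series) :=
  exists p h, M p /\ f = eval_x p + 3%:R ^+ R * h.

Lemma dilate3_int (c : int) : dilate 3 c%:~R = c%:~R. Proof. exact: rmorph_int. Qed.

Lemma sect0_intM (c : int) f : sect 0 (c%:~R * f) = c%:~R * sect 0 f.
Proof. by rewrite -[in LHS]dilate3_int sect_dilateM. Qed.

Lemma sect0_natM n f : sect 0 (n%:R * f) = n%:R * sect 0 f.
Proof. by rewrite -[in LHS]dilate3_nat sect_dilateM. Qed.

Lemma sect0_nat_expM n k f : sect 0 (n%:R ^+ k * f) = n%:R ^+ k * sect 0 f.
Proof. by rewrite -natrX sect0_natM. Qed.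

Lemma sect_sum I (r : seq I) (F : I -> series) :
  sect 0 (\sum_(i <- r) F i) = \sum_(i <- r) sect 0 (F i).
Proof. exact: (big_morph (sect 0) (sectD 0) (raddf0 (sect 0))). Qed.

Lemma sect0_comb f t p : (forall k, sect 0 (f * x ^+ k) = eval_x (t k)) ->
  sect 0 (f * eval_x p) = eval_x (comb t p).
Proof.
move=> ft; rewrite eval_x_sum mulr_sumr sect_sum /comb rmorph_sum; apply: eq_bigr => k _.
by rewrite mulrCA sect0_intM ft -eval_xZ.
Qed.

Lemma sect0_eval_x p : sect 0 (eval_x p) = eval_x (comb Upol p).
Proof. by rewrite -[eval_x p]mul1r; apply: sect0_comb => k; rewrite mul1r sect0_x. Qed.

Lemma rep_sect0 R f : represented good_odd R.+2 f ->
  exists2 g, sect 0 f = 9%:R * g & represented good_even R g.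
Proof.
case=> p [h [Mp ->]]; have [r [Mr er]] := comb_Upol Mp.
exists (eval_x r + 3%:R ^+ R * sect 0 h); last by exists r, (sect 0 h).
by rewrite sectD sect0_eval_x er eval_xZ sect0_nat_expM 2!exprS; ring.
Qed.

Lemma good_odd_add p r : good_odd p -> good_odd r -> good_odd (p + r).
Proof.
case=> [[p0 dp] sp] [[r0 dr] sr]; split; first split.
- by rewrite coefD p0 r0.
- by move=> k k4; rewrite coefD rpredD ?dp ?dr.
- rewrite !coefD [X in (_ %| X)%Z](_ : _ = (p`_1 + p`_2 + p`_3) + (r`_1 + r`_2 + r`_3)).
    exact: rpredD.
  ring.
Qed.

(** The shift of degree costs one power of 3 and the factor 9 gains two; in degree 4 the factor 9
    alone suffices. *)
Lemma good_odd_9X p : good_odd p -> good_odd (- 9%:R * 'X * p).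
Proof.
case=> [[p0 dp] sp].
have c j : (- 9%:R * 'X * p)`_j = 9 * - ('X * p)`_j.
  by rewrite -mulrA mulNr coefN coef_natrM mulrN.
split; first split.
- by rewrite c coefXM oppr0 mulr0.
- move=> k k4; rewrite c coefXM.
  case: k k4 => // k k4 /=.
  have [->|neq] := eqVneq k 3%N; first exact: dvdz_mulr.
  have -> : (k.+1 - 2 = 2 + (k - 3))%N by lia.
  rewrite exprD; apply: dvdz_mul => //; rewrite rpredN.
  by apply: dvd3_leq (dp k _); lia.
- by rewrite !c -!mulrDr dvdz_mulr.
Qed.

Lemma good_odd0 : good_odd 0.
Proof. by split; [split=> [|k _]|]; rewrite !coef0 ?dvdz0. Qed.

(* 1 / (1 + 9 x) is a geometric series, and multiplication by 9 x preserves good_odd. *)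
Lemma rep_div R g b : good_odd b -> (1 + 9%:R * x) * g = eval_x b -> represented good_odd R g.
Proof.
move=> Mb eg; pose y : {poly int} := - 9%:R * 'X.
have Mi i : good_odd (y ^+ i * b).
  elim: i => [|i IHi]; first by rewrite mul1r.
  by rewrite exprS -mulrA; apply: good_odd_9X.
(* The remainder after R terms is (-9x)^R g, which contains 3^(2R); one factor 3^R is kept in the
   second witness. *)
exists (\sum_(i < R) y ^+ i * b), (3%:R ^+ R * (- x) ^+ R * g); split.
  by apply: (big_ind good_odd) => //; [apply: good_odd0|apply: good_odd_add].
have ey : eval_x y = - 9%:R * x by rewrite /y eval_xM rmorphN rmorph_nat eval_x_X.
rewrite -mulr_suml eval_xM -eg.
have -> : eval_x (\sum_(i < R) y ^+ i) = \sum_(i < R) (- 9%:R * x) ^+ i.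
  by rewrite rmorph_sum; apply: eq_bigr => i _; rewrite rmorphXn /= ey.
have := subrX1 (- 9%:R * x) R; move: (\sum_(i < R) _) => s es.
have e9 : (- 9%:R * x) ^+ R = 3%:R ^+ R * 3%:R ^+ R * (- x) ^+ R.
  by rewrite -!exprMn; congr (_ ^+ _); ring.
transitivity (- ((- 9%:R * x - 1) * s) * g + (- 9%:R * x) ^+ R * g); last by rewrite e9; ring.
by rewrite -es; ring.
Qed.

Lemma sect0_w_eval_x p : (1 + 9%:R * x) * sect 0 (w * eval_x p) = eval_x (comb Vpol p).
Proof.
rewrite -sect_dilateM -(sect0_comb _ sect0_wx) dilate3D dilate3M dilate3_nat dilate3_1;
  congr (sect 0 _); ring.
Qed.

Lemma rep_sect0w R f : represented good_even R f -> represented good_odd R (sect 0 (w * f)).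
Proof.
case=> p [h [Mp ->]]; have [r [k [Mr er]]] := rep_div R (comb_Vpol Mp) (sect0_w_eval_x p).
exists r, (k + sect 0 (w * h)); split=> //.
by rewrite mulrDr sectD er [w * _]mulrCA sect0_nat_expM; ring.
Qed.

Lemma rep_sect0_w R : exists2 g, sect 0 w = 3%:R * g & represented good_odd R g.
Proof.
have [r [Mr er]] := Vpol0.
have ec : comb Vpol 1 = Vpol 0.
  by rewrite /comb size_poly1 big_ord1 coef1 scale1r.
pose g := sinv (1 + 9%:R * x) * eval_x r.
have x0 : x 0%N = 0 by rewrite xE !(scoefD, scoef_natM, exprS, smul_coef0) u0; ring.
have c0 : (1 + 9%:R * x) 0%N = 1 by rewrite scoefD scoef_natM x0 mulr0 addr0.
have eg : (1 + 9%:R * x) * g = eval_x r by rewrite /g mulrA [_ * sinv _]mulrC sinvK ?mul1r.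
exists g; last exact: rep_div Mr eg.
apply: (smulI c0); have := sect0_w_eval_x 1; rewrite rmorph1 mulr1 => ->.
by rewrite ec er eval_xZ -eg; ring.
Qed.

(* The coefficient of q^m is d2 (3^(2a+1) m - (9^(a+1) - 1)/8), and sect 0 (d2_odd a)
   collects the d2 (9^(a+1) m - (9^(a+1) - 1)/8). *)
Fixpoint d2_odd (a : nat) : series :=
  sect 0 (q * if a is b.+1 then sect 0 (d2_odd b) else Series d2).

(** U_3 strips one dilation from D(q^3) and yields 9; multiplication by q turns D into D(q^9) w, and
    the next U_3 restores D(q^3). *)
Lemma d2_odd_rep a R :
  exists2 f, d2_odd a = 3%:R ^+ (2 * a + 1) * (dilate 3 (Series d2) * f)
           & represented good_odd R f.
Proof.
elim: a R => [|a IHa] R.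
  have [g eg rg] := rep_sect0_w R; exists g => //=.
  by rewrite q_d2 sect_dilateM eg; ring.
(* Division by 9 costs two powers of precision. *)
have [f ef rf] := IHa R.+2; have [g eg rg] := rep_sect0 rf.
exists (sect 0 (w * g)); last exact: rep_sect0w.
rewrite [d2_odd a.+1]/= ef sect0_nat_expM sect_dilateM eg.
have -> : 3%:R ^+ (2 * a.+1 + 1) = 3%:R ^+ (2 * a + 1) * 9%:R :> series.
  rewrite (_ : 2 * a.+1 + 1 = 2 * a + 1 + 2)%N; last by lia.
  by rewrite [LHS]exprD; congr (_ * _); ring.
have -> : q * (3%:R ^+ (2 * a + 1) * (Series d2 * (9%:R * g)))
    = 3%:R ^+ (2 * a + 1) * (9%:R * (dilate 3 (dilate 3 (Series d2)) * (w * g))).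
  move: (_ ^+ _) => c; transitivity (c * 9%:R * (q * Series d2 * g)); first by ring.
  by rewrite q_d2; ring.
by rewrite sect0_nat_expM sect0_natM sect_dilateM; move: (_ ^+ _) => c; ring.
Qed.

(** The relation says n = 3^(2a+1) m - (9^(a+1) - 1)/8, free of subtraction and division; it forces
    m > 0, which absorbs the shift by q. *)
Lemma d2_odd_coef a m n :
  (8 * n + 9 ^ a.+1 = 24 * 9 ^ a * m + 1)%N -> d2_odd a m = d2 n.
Proof.
elim: a m n => [|a IHa] m n; rewrite ?[(9 ^ a.+2)%N]expnS expnS => e.
  rewrite scoef_sect scoef_qM.
  by case: m e => [|m] e; [lia | rewrite (_ : 3 * m.+1 + 0 = (3 * m).+3)%N; [congr d2;
    lia|lia]].
rewrite [d2_odd a.+1]/= scoef_sect scoef_qM; case: m e => [|m] e.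
  by have := expn_gt0 9 a; lia.
rewrite (_ : 3 * m.+1 + 0 = (3 * m).+3)%N; last by lia.
by rewrite scoef_sect; apply: IHa; rewrite expnS; lia.
Qed.

Lemma dvd_scoef (c : nat) k (f : series) n : (c%:Z ^+ k %| (c%:R ^+ k * f) n)%Z.
Proof. by rewrite -natrX scoef_natM natrX [c%:R]natz dvdz_mulr. Qed.

Lemma expn9_mod8 a : exists t, (9 ^ a = 8 * t + 1)%N.
Proof.
elim: a => [|a [t IHa]]; first by exists 0%N.
by exists (9 * t + 1)%N; rewrite expnS IHa; lia.
Qed.

Theorem theorem1p2 (n alpha : nat) (hn : (1 <= n)%N) (halpha : (1 <= alpha)%N)
    (h : (8 * n = 1 %[mod 3 ^ alpha])%N) :
  (d2 n = 0 %[mod 3 ^+ (2 * (alpha %/ 2) + 1)%N])%Z.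
Proof.
apply/eqP; rewrite eqz_mod_dvd subr0.
have [k ek] : exists k, (8 * n = k * 3 ^ alpha + 1)%N.
  have : (3 ^ alpha %| 8 * n - 1)%N by rewrite -eqn_mod_dvd; [apply/eqP | lia].
  by case/dvdnP => k e; exists k; lia.
have := odd_double_half alpha; rewrite -divn2; move: (alpha %/ 2)%N => a;
  case: (odd alpha) => ea.
  have [t et] := expn9_mod8 a.
  have e3 : (3 ^ alpha = 3 * 9 ^ a)%N by rewrite -ea expnD -muln2 [(a * 2)%N]mulnC expnM.
  (* As 9^a = 1 mod 8, the equation for 8n gives 3k = -1, hence k = -3 mod 8. *)
  have [m em] : exists m, (k + 3 = 8 * m)%N by exists ((k + 3) %/ 8)%N; nia.
  rewrite -(@d2_odd_coef a m n); last by rewrite ek e3 expnS; nia.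
  by have [f -> _] := d2_odd_rep a 0; apply: dvd_scoef.
case: a ea => [|a] ea; first by lia.
have [t et] := expn9_mod8 a.
have e3 : (3 ^ alpha = 9 * 9 ^ a)%N by rewrite -ea -muln2 add0n [(a.+1 * 2)%N]mulnC expnM expnS.
(* Here k = -1 mod 8, and n has index 3m in [d2_odd a], so one more U_3 applies. *)
have [m em] : exists m, (k + 1 = 8 * m)%N by exists ((k + 1) %/ 8)%N; nia.
rewrite -(@d2_odd_coef a (3 * m) n); last by rewrite ek e3 expnS; nia.
have -> : d2_odd a (3 * m)%N = sect 0 (d2_odd a) m by rewrite scoef_sect addn0.
(* Precision 2 is what [rep_sect0] needs to extract the last factor 9. *)
have [f -> rf] := d2_odd_rep a 2; have [g eg _] := rep_sect0 rf.
rewrite sect0_nat_expM sect_dilateM eg.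
rewrite (_ : _ * (_ * _) = 3%:R ^+ (2 * a.+1 + 1) * (Series d2 * g)); first exact: dvd_scoef.
have -> : (2 * a.+1 + 1 = 2 * a + 1 + 2)%N by lia.
rewrite [in RHS]exprD; move: (_ ^+ (2 * a + 1)) => c; ring.
Qed.
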